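(* Let $\lambda>-\frac12$ and $n\in\mathbb{N}_0$. The Fisher information of the Gegenbauer polynomial $C_n^{(\lambda)}(x)$ with respect to the parameter $\lambda$, $$I_n^{(C)}(\lambda)=4\int_{-1}^1\left\{\frac{\partial}{\partial\lambda}\Big(\big[(1-x^2)^{\lambda-\frac12}\big]^{1/2}\tilde C_n^{(\lambda)}(x)\Big)\right\}^2dx,$$ where $\tilde C_n^{(\lambda)}$ is the corresponding orthonormal polynomial, has the value $$I_n^{(C)}(\lambda)=\frac{16\,n!\,(n+\lambda)}{\Gamma(n+2\lambda)}\sum_{k=0}^{n-1}\frac{\big(1+(-1)^{n-k}\big)\Gamma(k+2\lambda)(k+\lambda)}{k!\,(k+n+2\lambda)^2(n-k)^2}-2\psi^{(1)}(n+\lambda)+4\psi^{(1)}(n+2\lambda)+\frac{1}{(n+\lambda)^2}.$$ For $\lambda=0$ the formally indeterminate expressions on the right-hand side are understood by continuity (e.g. $\Gamma(2\lambda)\lambda=\frac12\Gamma(2\lambda+1)$ in the $k=0$ term).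
   Context: The orthonormal Gegenbauer polynomials $\tilde C_n^{(\lambda)}$, $\deg\tilde C_n^{(\lambda)}=n$, have positive leading coefficient and satisfy $\int_{-1}^1\tilde C_n^{(\lambda)}(x)\tilde C_m^{(\lambda)}(x)(1-x^2)^{\lambda-\frac12}dx=\delta_{nm}$; for $\lambda\ne0$, $\tilde C_n^{(\lambda)}$ is the normalization (up to sign) of the Gegenbauer polynomial $C_n^{(\lambda)}(x)=\frac{(2\lambda)_n}{(\lambda+\frac12)_n}P_n^{(\lambda-\frac12,\lambda-\frac12)}(x)$, whose squared norm is $\frac{\pi2^{1-2\lambda}\Gamma(n+2\lambda)}{n!(n+\lambda)\Gamma^2(\lambda)}$. Here $P_n^{(\alpha,\beta)}$ are Jacobi polynomials and $(x)_m$ is the Pochhammer symbol. $\psi^{(1)}(x)=\frac{d^2}{dx^2}\ln\Gamma(x)$ is the trigamma function. *)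

(* Defs.v *)
From HB Require Import structures.
From mathcomp Require Import all_boot all_order all_algebra.
From mathcomp Require Import all_classical all_reals all_analysis.
Import Order.TTheory GRing.Theory Num.Theory.
Import numFieldNormedType.Exports.

Set Implicit Arguments.
Unset Strict Implicit.
Unset Printing Implicit Defensive.

Local Open Scope classical_set_scope.
Local Open Scope ring_scope.

Section Gamma.
Variable R : realType.
Local Notation mu := (@lebesgue_measure R).

(* Euler's integral; it is finite exactly when 0 < x. *)
Definition euler_integral (x : R) : R :=
  fine (\int[mu]_(t in `]0%R, +oo[) (t `^ (x - 1) * expR (- t))%:E)%E.

(* Continuation to x <= 0 by Gamma x = Gamma (x + m) / (x (x+1) ... (x+m-1)),
   with the least m such that 0 < x + m. At the poles 0, -1, -2, ... one
   factor vanishes and the value is 0 by the convention 0^-1 = 0. *)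
Definition Gamma (x : R) : R :=
  if 0 < x then euler_integral x
  else let m := (Num.truncn (- x)).+1 in
       euler_integral (x + m%:R) / \prod_(i < m) (x + i%:R).

(* The absolute value matters only for x < 0, where Gamma may be negative:
   the real derivative of ln |Gamma| is Gamma' / Gamma on both sides. *)
Definition trigamma (x : R) : R :=
  derive1n 2 (fun y : R => ln `|Gamma y|) x.

End Gamma.

Section Gegenbauer.
Variable R : realType.
Local Notation mu := (@lebesgue_measure R).

Definition gegenbauer_weight (l x : R) : R := (1 - x ^+ 2) `^ (l - 2^-1).

(* These conditions determine the sequence p uniquely. *)
Definition orthonormal_gegenbauer (l : R) (p : nat -> {poly R}) : Prop :=
  [/\ forall n, size (p n) = n.+1,
      forall n, 0 < lead_coef (p n)
    & forall n m : nat,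
        (\int[mu]_(x in `[(-1)%R, 1%R])
           ((p n).[x] * (p m).[x] * gegenbauer_weight l x)%:E)%E
        = ((n == m)%:R)%:E].

(* C l n is the orthonormal polynomial of degree n with parameter l. *)
Definition gegenbauer_fisher (C : R -> nat -> {poly R}) (n : nat) (lam : R)
    : \bar R :=
  (4%:E * \int[mu]_(x in `[(-1)%R, 1%R])
     ((derive1 (fun l : R => Num.sqrt (gegenbauer_weight l x) * (C l n).[x]) lam)
        ^+ 2)%:E)%E.

Definition gegenbauer_fisher_value (n : nat) (lam : R) : R :=
  16 * n`!%:R * (n%:R + lam) / Gamma (n%:R + 2 * lam)
    * (\sum_(k < n)
         (1 + (-1) ^+ (n - k)) * Gamma (k%:R + 2 * lam) * (k%:R + lam)
         / (k`!%:R * (k%:R + n%:R + 2 * lam) ^+ 2 * (n%:R - k%:R) ^+ 2))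
  - 2 * trigamma (n%:R + lam)
  + 4 * trigamma (n%:R + 2 * lam)
  + 1 / (n%:R + lam) ^+ 2.

End Gegenbauer.

(* Main.v *)
(** Let [P_n] be the monic Gegenbauer polynomials, [h_n] their squared norms and
    [d] the derivative in [l].  The orthonormal polynomial is [h_n^(-1/2) P_n], and
    differentiating the relations [<P_n, P_n> = h_n] and [<P_n, P_k> = 0] gives
      [I_n = (ln h_n)'' + (2 / h_n) sum_(k < n) <d P_n, P_k>^2 / h_k].
    The eigenvalue equation of [P_n], differentiated in [l] and paired with [P_k],
    reads [(n - k) (n + k + 2 l) <d P_n, P_k> = 2 <x P_n', P_k>], and the right-hand
    side follows from the contiguity relations between [x P_n'], [P_n] and
    [P_(n-1)'].  Finally [h_n] is [h_0] times the coefficients of the three-term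
    recurrence; to express [(ln h_0)''] by the trigamma function no beta integral is
    needed: by the functional equations of [h_0] and Gamma, the difference between
    [(ln h_0)''] and [4 psi'(2 l + 1) - 2 psi'(l + 1)] is 1-periodic, and it vanishes
    at infinity because both second derivatives are variances of logarithms. *)

Require Import Defs.
From HB Require Import structures.
From mathcomp Require Import all_boot all_order all_algebra.
From mathcomp Require Import all_classical all_reals all_analysis.
From mathcomp Require Import measurable_realfun.
From mathcomp Require Import ring lra.
Import Order.TTheory GRing.Theory Num.Theory.
Import numFieldNormedType.Exports.

Set Implicit Arguments.
Unset Strict Implicit.
Unset Printing Implicit Defensive.

Local Open Scope classical_set_scope.
Local Open Scope ring_scope.

(** * Improper integrals and Mellin transforms *)

(** Monic normalization is what makes the parameter derivative tractable: the leading coefficient is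
    constant, so [dgpoly l n] has degree below [n], is orthogonal to [gpoly l n] and expands in the
    [gpoly l k] with [k < n]. The orthonormal family is given separately for each parameter; only
    its uniqueness shows that it varies differentiably. The 1-periodic difference is forced to zero
    by a quantitative bound: the variance of a logarithm is controlled by three consecutive moments,
    whose ratios the functional equations make rational, and this gives a decay of order 1/l. The
    obstacle is [l = 0], together with [l < 0] when [n = 0]: the stated value then contains Gamma
    and trigamma at zero or at negative arguments. All intermediate formulas are therefore written
    with Euler's integral and a trigamma function at arguments that stay positive on the whole
    half-line [- 2^-1 < l]; the stated value is compared with them only for [l != 0], and continuity
    supplies the limit. *)

Section ImproperFTC.
Variable R : realType.
Local Notation mu := (@lebesgue_measure R).
Variables (D : set R) (a b : nat -> R) (G g : R -> R).
Hypothesis oD : open D.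
Hypothesis ab : forall n, a n < b n.
Hypothesis abD : forall n, `[a n, b n] `<=` D.
Hypothesis exh : forall x, D x -> \forall n \near \oo, x \in `[a n, b n].
Hypothesis dG : forall x, D x -> is_derive x 1 G (g x).
Hypothesis cg : {in D, continuous g}.

Let mD : measurable D. Proof. exact: open_measurable. Qed.

Let mg : measurable_fun D g.
Proof. exact: open_continuous_measurable_fun. Qed.

Let gn n := (EFin \o g) \_ `[a n, b n].

Let mgn n : measurable_fun D (gn n).
Proof.
apply/(measurable_restrict (EFin \o g)) => //.
by apply/measurable_EFinP; apply: measurable_funS mg => // x [].
Qed.

Let cvg_gn x : D x -> gn ^~ x @ \oo --> (g x)%:E.
Proof.
move=> Dx; apply: cvg_near_cst.
have := exh Dx; apply: filterS => n abx.
by rewrite /gn patchE mem_set.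
Qed.

Let int_gn n : (\int[mu]_(x in D) gn n x = (G (b n) - G (a n))%:E)%E.
Proof.
rewrite -integral_mkcondr setIidr// EFinB.
apply: continuous_FTC2 => //.
- apply: continuous_in_subspaceT => x; rewrite inE => abx.
  by apply: cg; rewrite inE; exact: abD abx.
- have cG x : D x -> {for x, continuous G}.
    move=> Dx; apply: differentiable_continuous; apply/derivable1_diffP.
    exact: (@ex_derive _ _ _ _ _ _ _ (dG Dx)).
  split.
  + move=> x xab; apply: (@ex_derive _ _ _ _ _ _ _ (dG _)).
    by apply: (abD (n := n)); exact: subset_itv_oo_cc.
  + apply: cvg_at_right_filter; apply: cG; apply: (abD (n := n)) => /=.
    by rewrite in_itv/= lexx/= ltW.
  + apply: cvg_at_left_filter; apply: cG; apply: (abD (n := n)) => /=.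
    by rewrite in_itv/= lexx/= ltW.
- move=> x xab; rewrite derive1E; apply: derive_val; apply: dG.
  by apply: (abD (n := n)); exact: subset_itv_oo_cc.
Qed.

(** The integrals over the exhausting intervals are [G (b n) - G (a n)], hence at most [M + M], and
    Fatou's lemma passes this bound to the limit. An explicit bounded antiderivative thus proves
    integrability before any boundary limit is known. *)
Lemma integrable_bounded_primitive (M : R) :
  (forall x, D x -> 0 <= g x) -> (forall x, D x -> `|G x| <= M) ->
  mu.-integrable D (EFin \o g).
Proof.
move=> g0 GM; apply/integrableP; split; first exact/measurable_EFinP.
have e x : x \in D -> (abse ((EFin \o g) x) = limn_einf (gn ^~ x)).
  rewrite inE => Dx; rewrite gee0_abs ?lee_fin ?g0//.
  by have [->] := cvg_limn_einf_sup (cvg_gn Dx).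
under eq_integral do rewrite e//.
apply: (le_lt_trans (fatou mu mD mgn _)).
  move=> n x Dx; rewrite /gn patchE; case: ifPn => // _.
  by rewrite lee_fin g0.
apply: (@le_lt_trans _ _ (M + M)%:E); last exact: ltry.
rewrite limn_einf_lim; apply: lime_le; first exact: is_cvg_einfs.
apply: nearW => n.
apply: (@le_trans _ _ (\int[mu]_(x in D) gn n x)%E).
  by apply: ereal_inf_lbound; exists n => /=.
rewrite int_gn lee_fin.
apply: (le_trans (ler_norm _)); apply: (le_trans (ler_normB _ _)).
have An : a n <= b n by rewrite ltW.
by apply: lerD; apply: GM; apply: (abD (n := n)); rewrite /= in_itv/= lexx ?An.
Qed.

(** Dominated convergence for the truncations of [g], with majorant [|g|]. *)
Lemma improper_FTC2 (la lb : R) : mu.-integrable D (EFin \o g) ->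
  G (a n) @[n --> \oo] --> la -> G (b n) @[n --> \oo] --> lb ->
  \int[mu]_(x in D) g x = lb - la.
Proof.
move=> ig Ga Gb.
have [||||_ _] := @dominated_convergence _ _ _ mu D mD gn (EFin \o g)
  (abse \o EFin \o g) mgn.
- exact/measurable_EFinP.
- by apply: aeW => x Dx; exact: cvg_gn.
- exact: integrable_abse ig.
- apply: aeW => x n Dx; rewrite /gn patchE; case: ifPn => //= _.
  by rewrite normr0 lee_fin.
move=> h; rewrite /Rintegral.
have -> : (\int[mu]_(x in D) (EFin \o g) x = (lb - la)%:E)%E; last by [].
apply/esym/(@cvg_unique _ _ _ _ _ _ _ h).
- exact: ereal_hausdorff.
rewrite (_ : [sequence _]_n = fun n => (G (b n) - G (a n))%:E); last first.
  by apply/funext => n; exact: int_gn.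
by apply: cvg_EFin; [exact: nearW|]; exact: cvgB.
Qed.

End ImproperFTC.

(** * Derivative rules and a locally uniform bound on logarithmic factors *)

Section Calculus.
Variable R : realType.
Implicit Types f g : R -> R.

Lemma is_deriveE f (x a b : R) : is_derive x 1 f a -> a = b -> is_derive x 1 f b.
Proof. by move=> h <-. Qed.

Lemma is_derive1_cst (c x : R) : is_derive x 1 (fun=> c) 0.
Proof. exact: is_derive_cst. Qed.

Lemma is_derive1_id (x : R) : is_derive x 1 (fun y : R => y) 1.
Proof. exact: is_derive_id. Qed.

Lemma is_derive1D f g (x a b : R) : is_derive x 1 f a -> is_derive x 1 g b ->
  is_derive x 1 (fun y => f y + g y) (a + b).
Proof. by move=> ? ?; exact: is_deriveD. Qed.

Lemma is_derive1N f (x a : R) : is_derive x 1 f a ->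
  is_derive x 1 (fun y => - f y) (- a).
Proof. by move=> ?; exact: is_deriveN. Qed.

Lemma is_derive1B f g (x a b : R) : is_derive x 1 f a -> is_derive x 1 g b ->
  is_derive x 1 (fun y => f y - g y) (a - b).
Proof. by move=> ? ?; exact: is_deriveB. Qed.

Lemma is_derive1M f g (x a b : R) : is_derive x 1 f a -> is_derive x 1 g b ->
  is_derive x 1 (fun y => f y * g y) (a * g x + f x * b).
Proof.
move=> fa gb; apply: (is_deriveE (is_deriveM fa gb)).
by rewrite addrC mulrC.
Qed.

Lemma is_derive1V f (x a : R) : f x != 0 -> is_derive x 1 f a ->
  is_derive x 1 (fun y => (f y)^-1) (- a / f x ^+ 2).
Proof.
move=> fx fa; apply: (is_deriveE (is_deriveV fx fa)).
by rewrite /GRing.scale/= !mulNr mulrC.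
Qed.

Lemma is_derive1_compose f g (x a b : R) : is_derive (g x) 1 f a ->
  is_derive x 1 g b -> is_derive x 1 (fun y => f (g y)) (a * b).
Proof. by move=> fa gb; exact: (is_derive1_comp fa gb). Qed.

Lemma is_derive1_sum n (f : 'I_n -> R -> R) (a : 'I_n -> R) (x : R) :
  (forall i, is_derive x 1 (f i) (a i)) ->
  is_derive x 1 (fun y => \sum_(i < n) f i y) (\sum_(i < n) a i).
Proof.
move=> h; have := is_derive_sum h.
by rewrite (_ : (\sum_(i < n) f i) = (fun y => \sum_(i < n) f i y))// funeqE => y;
  rewrite fct_sumE.
Qed.

Lemma is_derive1_unique f (x a b : R) :
  is_derive x 1 f a -> is_derive x 1 f b -> a = b.
Proof. by move=> [_ <-] [_ <-]. Qed.

Lemma is_derive1_continuous f (x a : R) :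
  is_derive x 1 f a -> {for x, continuous f}.
Proof.
by move=> [fa _]; apply: differentiable_continuous; exact/derivable1_diffP.
Qed.

Lemma powRE (p s : R) : 0 < p -> p `^ s = expR (s * ln p).
Proof. by move=> p0; rewrite /powR gt_eqF. Qed.

Lemma is_derive_powRr (p s : R) : 0 < p ->
  is_derive s 1 (fun s => p `^ s) (ln p * p `^ s).
Proof.
move=> p0; under eq_fun do rewrite powRE//.
have dl : is_derive s 1 (fun s => s * ln p) (ln p).
  apply: (is_deriveE (is_derive1M (is_derive1_id s) (is_derive1_cst (ln p) s))).
  by rewrite mul1r mulr0 addr0.
apply: (is_deriveE (is_derive1_compose (is_derive_expR _) dl)).
by rewrite powRE// mulrC.
Qed.

Lemma expr_le_expR (x : R) k : 0 <= x -> x ^+ k <= k`!%:R * expR x.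
Proof.
move=> x0; case: k => [|k]; first by rewrite expr0 fact0 mul1r -expR0 ler_expR.
have k0 : 0 < (k.+1)`!%:R :> R by rewrite ltr0n fact_gt0.
rewrite mulrC -ler_pdivrMr//.
by apply: le_trans (expR_ge1Dxn k x0); rewrite lerDr.
Qed.

(** With [u = ln p], one [e] absorbs the logarithms through
    [|u| ^+ k <= k! / e ^+ k * expR (e * |u|)], the other pays for moving the exponent from [s] to
    [t]; the two signs of [u] give the two exponents. The bound is uniform in [s], as
    differentiation under the integral requires. *)
Lemma norm_ln_powR_le (p s t e : R) k : 0 < p -> 0 < e -> `|s - t| <= e ->
  `|ln p ^+ k * p `^ s| <= k`!%:R / e ^+ k * (p `^ (t - e *+ 2) + p `^ (t + e *+ 2)).
Proof.
move=> p0 e0 st; rewrite normrM normrX [X in _ * X]ger0_norm ?powR_ge0//.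
rewrite !powRE//; set u := ln p.
have h1 : `|u| ^+ k <= k`!%:R / e ^+ k * expR (e * `|u|).
  rewrite mulrAC ler_pdivlMr ?exprn_gt0// mulrC -exprMn.
  by apply: expr_le_expR; rewrite mulr_ge0// ltW.
have h2 : s * u <= t * u + e * `|u|.
  rewrite -lerBlDl -mulrBl; apply: (le_trans (ler_norm _)).
  by rewrite normrM ler_wpM2r.
have h3 : expR (e * `|u|) * expR (s * u) <=
    expR ((t - e *+ 2) * u) + expR ((t + e *+ 2) * u).
  rewrite -expRD; have [u0|u0] := leP 0 u.
    apply: ler_wpDl; first exact: expR_ge0.
    by rewrite ler_expR; move: h2; rewrite ger0_norm//; lra.
  apply: ler_wpDr; first exact: expR_ge0.
  by rewrite ler_expR; move: h2; rewrite ltr0_norm//; lra.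
apply: (le_trans (ler_wpM2r _ h1)); first exact: expR_ge0.
by rewrite -[leLHS]mulrA ler_wpM2l// divr_ge0// exprn_ge0// ltW.
Qed.

End Calculus.

Lemma Rintegral_gt0 d (T : measurableType d) (R : realType)
    (mu : {measure set T -> \bar R}) (D : set T) (f : T -> R) :
  measurable D -> mu D != 0%E -> mu.-integrable D (EFin \o f) ->
  (forall t, D t -> 0 < f t) -> 0 < \int[mu]_(t in D) f t.
Proof.
move=> mD D0 fi f0.
have e0 : 0 <= \int[mu]_(t in D) f t by apply: Rintegral_ge0 => t /f0/ltW.
rewrite lt_neqAle e0 andbT; apply: contra D0 => /eqP z.
have : (\int[mu]_(t in D) `|(EFin \o f) t| = 0)%E.
  under eq_integral => t /set_mem Dt do rewrite gee0_abs ?lee_fin ?(ltW (f0 _ Dt))//.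
  by rewrite -(fineK (integrable_fin_num mD fi)); congr EFin; exact/esym/z.
move/(ae_eq_integral_abs _ mD (measurable_int _ fi)) => [N [mN N0 sub]].
have DN : D `<=` N.
  by move=> t Dt; apply: sub => /= /(_ Dt)/eqP; rewrite eqe gt_eqF// f0.
have : (mu D <= mu N)%E by apply: le_measure; rewrite ?inE.
by rewrite N0 measure_le0.
Qed.

(** * Mellin transforms and differentiation under the integral sign *)

Section Mellin.
Context d (T : measurableType d) (R : realType).
Variables (mu : {measure set T -> \bar R}) (D : set T) (phi h : T -> R).
Implicit Types (k : nat) (e s : R) (t : T).
Hypothesis mD : measurable D.
Hypothesis mphi : measurable_fun D phi.
Hypothesis mh : measurable_fun D h.
Hypothesis phi_gt0 : forall t, D t -> 0 < phi t.
Hypothesis ih : forall s : R, -1 < s ->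
  mu.-integrable D (EFin \o (fun t => phi t `^ s * h t)).

Definition mellin_integrand k s t := ln (phi t) ^+ k * phi t `^ s * h t.

Definition mellin k s := \int[mu]_(t in D) mellin_integrand k s t.

Let measurable_mellin_integrand k s : measurable_fun D (mellin_integrand k s).
Proof.
apply: measurable_funM => //; apply: measurable_funM.
  by apply: measurable_funX; exact: measurableT_comp.
exact: (measurableT_comp (measurable_powR s)).
Qed.

Let dom k e (t0 : R) t := k`!%:R / e ^+ k *
  (phi t `^ (t0 - e *+ 2) * `|h t| + phi t `^ (t0 + e *+ 2) * `|h t|).

Let integrable_dom k e (t0 : R) : 0 < e -> -1 < t0 - e *+ 2 ->
  mu.-integrable D (EFin \o dom k e t0).
Proof.
move=> e0 te; have te' : -1 < t0 + e *+ 2 by lra.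
have ihn s : -1 < s -> mu.-integrable D (EFin \o (fun t => phi t `^ s * `|h t|)).
  move=> s1; apply: eq_integrable (integrable_norm (ih s1)) => //.
  by move=> t _ /=; rewrite normrM [`|_ `^ _|]ger0_norm ?powR_ge0.
have := integrableZl mD (k`!%:R / e ^+ k) (integrableD mD (ihn _ te) (ihn _ te')).
by apply: eq_integrable => // t _ /=; rewrite /dom EFinM EFinD.
Qed.

Let mellin_dom k e s (t0 : R) t : 0 < e -> D t -> `|s - t0| <= e ->
  `|mellin_integrand k s t| <= dom k e t0 t.
Proof.
move=> e0 Dt se; rewrite /mellin_integrand /dom normrM -mulrDl mulrA ler_wpM2r//.
by apply: norm_ln_powR_le => //; exact: phi_gt0.
Qed.

Lemma integrable_mellin k s : -1 < s ->
  mu.-integrable D (EFin \o mellin_integrand k s).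
Proof.
(* This [e] puts [s - 2 e] midway between [-1] and [s], inside the domain of integrability. *)
move=> s1; pose e := (s + 1) / 4.
have e0 : 0 < e by rewrite /e; lra.
have es : -1 < s - e *+ 2 by rewrite /e; lra.
apply: le_integrable (integrable_dom k e0 es) => //.
  exact/measurable_EFinP.
move=> t Dt /=; rewrite lee_fin; apply: (@le_trans _ _ (dom k e s t)); last exact: ler_norm.
by apply: mellin_dom => //; rewrite subrr normr0 ltW.
Qed.

(** For exponents within [e] of [s], the differentiated integrand is dominated by the single
    function [dom k.+1 e s]. *)
Lemma is_derive_mellin k s : -1 < s ->
  is_derive s 1 (mellin k) (mellin k.+1 s).
Proof.
move=> s1; pose e := (s + 1) / 4.
have e0 : 0 < e by rewrite /e; lra.
have es : -1 < s - e *+ 2 by rewrite /e; lra.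
have Is : `]s - e, s + e[%classic s by rewrite /= in_itv/=; apply/andP; split; lra.
have dmi (x : R) t : D t -> is_derive x 1 (mellin_integrand k ^~ t) (mellin_integrand k.+1 x t).
  move=> Dt; have dp := is_derive_powRr x (phi_gt0 Dt).
  apply: (is_deriveE (is_derive1M (is_derive1M (is_derive1_cst _ x) dp)
    (is_derive1_cst _ x))).
  by rewrite /mellin_integrand exprS; ring.
have p1 (x : R) t : D t -> partial1of2 (mellin_integrand k) x t = mellin_integrand k.+1 x t.
  by move=> Dt; rewrite partial1of2E; apply: derive_val; exact: dmi.
have H1 (x : R) : `]s - e, s + e[%classic x -> mu.-integrable D (EFin \o mellin_integrand k x).
  rewrite /= in_itv/= => /andP[xs _]; apply: integrable_mellin; lra.
have H2 (x : R) t : `]s - e, s + e[%classic x -> D t -> derivable (mellin_integrand k ^~ t) x 1.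
  by move=> _ Dt; exact: (@ex_derive _ _ _ _ _ _ _ (dmi x t Dt)).
have H3 (x : R) t : `]s - e, s + e[%classic x -> D t ->
    `|partial1of2 (mellin_integrand k) x t| <= `|dom k.+1 e s t|.
  rewrite /= in_itv/= => /andP[xs sx] Dt; rewrite p1//.
  apply: le_trans (ler_norm _); apply: mellin_dom => //.
  by rewrite ler_norml; apply/andP; split; lra.
have iG := integrable_norm (integrable_dom k.+1 e0 es).
have G0 t : 0 <= (Num.Def.normr \o dom k.+1 e s) t by rewrite /=.
apply: DeriveDef.
  exact: (derivable_under_integral mD Is H1 H2 G0 iG H3).
rewrite -derive1E (differentiation_under_integral mD Is H1 H2 G0 iG H3).
by apply: eq_Rintegral => t; rewrite inE => Dt; exact: p1.
Qed.

End Mellin.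

(** * The variance of a logarithm and its decay *)

Section MellinVariance.
Context d (T : measurableType d) (R : realType).
Variables (mu : {measure set T -> \bar R}) (D : set T) (phi h : T -> R).
Implicit Types (s c : R) (t : T).
Hypothesis mD : measurable D.
Hypothesis mphi : measurable_fun D phi.
Hypothesis mh : measurable_fun D h.
Hypothesis phi_gt0 : forall t, D t -> 0 < phi t.
Hypothesis ih : forall s : R, -1 < s ->
  mu.-integrable D (EFin \o (fun t => phi t `^ s * h t)).
Hypothesis h_ge0 : forall t, D t -> 0 <= h t.
Hypothesis mellin_gt0 : forall s : R, -1 < s -> 0 < mellin mu D phi h 0 s.

Local Notation M := (mellin mu D phi h).
Local Notation m := (mellin_integrand phi h).

(** The variance of [ln phi] under the density proportional to [phi ^ s h]; it is also the second
    derivative of [ln (M 0 s)]. *)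
Definition mellin_var s := M 2 s / M 0 s - (M 1 s / M 0 s) ^+ 2.

Let iM k s (s1 : -1 < s) := integrable_mellin mD mphi mh phi_gt0 ih k s1.

(** [M 0 s] times the mean square deviation of [ln phi] from [c]. It is nonnegative and, as a
    function of [c], minimal at the mean; the two bounds on the variance come from these facts. *)
Let Q s c := M 2 s - 2 * c * M 1 s + c ^+ 2 * M 0 s.

Let QE s c : -1 < s ->
  Q s c = \int[mu]_(t in D) ((ln (phi t) - c) ^+ 2 * (phi t `^ s * h t)).
Proof.
move=> s1; rewrite /Q -mulNr.
have i1 := integrableZl mD (- (2 * c)) (iM 1 s1).
have i0 := integrableZl mD (c ^+ 2) (iM 0 s1).
have e1 : mu.-integrable D (EFin \o (fun t => - (2 * c) * m 1 s t)).
  by apply: eq_integrable i1.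
have e0 : mu.-integrable D (EFin \o (fun t => c ^+ 2 * m 0 s t)).
  by apply: eq_integrable i0.
have e2 : mu.-integrable D (EFin \o (fun t => m 2 s t + - (2 * c) * m 1 s t)).
  by apply: eq_integrable (integrableD mD (iM 2 s1) e1).
rewrite /mellin -!RintegralZl//; try exact: iM.
rewrite -RintegralD//; try exact: iM.
rewrite -RintegralD//.
by apply: eq_Rintegral => t _; rewrite /mellin_integrand; ring.
Qed.

Let Q_ge0 s c : -1 < s -> 0 <= Q s c.
Proof.
move=> s1; rewrite QE//; apply: Rintegral_ge0 => t Dt.
by rewrite mulr_ge0 ?sqr_ge0// mulr_ge0 ?powR_ge0 ?h_ge0.
Qed.

Let varE s c : -1 < s -> Q s c = M 0 s * (mellin_var s + (c - M 1 s / M 0 s) ^+ 2).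
Proof.
move=> s1; rewrite /Q /mellin_var; have := mellin_gt0 s1.
by move: (M 0 s) (M 1 s) (M 2 s) => x y z x0; field; rewrite gt_eqF.
Qed.

Lemma mellin_var_ge0 s : -1 < s -> 0 <= mellin_var s.
Proof.
move=> s1; have := Q_ge0 (M 1 s / M 0 s) s1.
by rewrite varE// subrr expr0n/= addr0 pmulr_rge0// mellin_gt0.
Qed.

(** With [u = ln (p / a)] the right-hand side is the square of [2 (e ^ (u / 2) - e ^ (- u / 2))],
    and this dominates [u] for [u >= 0] because [e ^ v >= 1 + v]. The bound is linear in [p] and
    [1 / p], so integrating it only shifts the Mellin exponent by one. *)
Let sqr_ln_le (p a : R) : 0 < p -> 0 < a ->
  (ln p - ln a) ^+ 2 <= 4 * (p / a - 2 + a / p).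
Proof.
move=> p0 a0; set u := ln p - ln a.
have -> : p / a = expR u by rewrite expRB !lnK.
have -> : a / p = expR (- u) by rewrite opprB expRB !lnK.
have key (v : R) : 0 <= v -> v <= 2 * (expR (v / 2) - expR (- v / 2)).
  move=> v0; have := expR_ge1Dx (v / 2).
  have : expR (- v / 2) <= 1 by rewrite expR_le1; lra.
  lra.
have e1 : expR u = expR (u / 2) ^+ 2 by rewrite expr2 -expRD; congr expR; field.
have e2 : expR (- u) = expR (- u / 2) ^+ 2.
  by rewrite expr2 -expRD; congr expR; field.
have e3 : expR (u / 2) * expR (- u / 2) = 1.
  by rewrite -expRD mulNr subrr expR0.
have -> : 4 * (expR u - 2 + expR (- u)) = (2 * (expR (u / 2) - expR (- u / 2))) ^+ 2.
  rewrite e1 e2; move: e3; move: (expR (u / 2)) (expR (- u / 2)) => X Y XY.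
  rewrite (_ : X ^+ 2 - 2 + Y ^+ 2 = X ^+ 2 - 2 * (X * Y) + Y ^+ 2).
    by ring.
  by rewrite XY mulr1.
have [u0|u0] := leP 0 u.
  by apply: lerXn2r; rewrite ?nnegrE// ?key//; apply: le_trans (key _ _).
rewrite -sqrrN -[leRHS]sqrrN.
have nu : 0 <= - u by lra.
have /= := key _ nu; rewrite opprK => ku.
by apply: lerXn2r; rewrite ?nnegrE; lra.
Qed.

(* The variance of [ln phi] is at most the mean square of [ln phi - ln a], and
   [(ln (p / a)) ^ 2 <= 4 (p / a - 2 + a / p)]. *)
Lemma mellin_var_le s (a : R) : 0 < s -> 0 < a ->
  mellin_var s <= 4 * (M 0 (s + 1) / a - 2 * M 0 s + a * M 0 (s - 1)) / M 0 s.
Proof.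
move=> s0 a0; have s1 : -1 < s by lra.
have sp : -1 < s + 1 by lra.
have sm : -1 < s - 1 by lra.
rewrite ler_pdivlMr ?mellin_gt0// mulrC.
apply: (@le_trans _ _ (Q s (ln a))).
  by rewrite varE// ler_pM2l ?mellin_gt0// lerDl sqr_ge0.
have ip : mu.-integrable D (EFin \o (fun t => a^-1 * m 0 (s + 1) t)).
  by apply: eq_integrable (integrableZl mD a^-1 (iM 0 sp)).
have im : mu.-integrable D (EFin \o (fun t => a * m 0 (s - 1) t)).
  by apply: eq_integrable (integrableZl mD a (iM 0 sm)).
have i0 : mu.-integrable D (EFin \o (fun t => - 2 * m 0 s t)).
  by apply: eq_integrable (integrableZl mD (- 2) (iM 0 s1)).
have ip0 : mu.-integrable D (EFin \o (fun t => a^-1 * m 0 (s + 1) t + - 2 * m 0 s t)).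
  by apply: eq_integrable (integrableD mD ip i0).
have ipm : mu.-integrable D (EFin \o
    (fun t => a^-1 * m 0 (s + 1) t + - 2 * m 0 s t + a * m 0 (s - 1) t)).
  by apply: eq_integrable (integrableD mD ip0 im).
rewrite (mulrC _ a^-1) -mulNr /mellin -!RintegralZl//; try exact: iM.
rewrite -!RintegralD//.
rewrite -RintegralZl// QE//; apply: le_Rintegral => //.
- have i1 : mu.-integrable D (EFin \o (fun t => - (2 * ln a) * m 1 s t)).
    by apply: eq_integrable (integrableZl mD (- (2 * ln a)) (iM 1 s1)).
  have i2 : mu.-integrable D (EFin \o (fun t => ln a ^+ 2 * m 0 s t)).
    by apply: eq_integrable (integrableZl mD (ln a ^+ 2) (iM 0 s1)).
  apply: eq_integrable (integrableD mD (integrableD mD (iM 2 s1) i1) i2) => //.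
  move=> t _ /=; rewrite -!EFinD; congr EFin.
  by rewrite /mellin_integrand; ring.
- by apply: eq_integrable (integrableZl mD 4 ipm).
move=> t Dt; have p0 := phi_gt0 Dt.
apply: (@le_trans _ _ (4 * (phi t / a - 2 + a / phi t) * (phi t `^ s * h t))).
  by rewrite ler_wpM2r ?sqr_ln_le// mulr_ge0 ?powR_ge0 ?h_ge0.
have pn0 : phi t != 0 by rewrite gt_eqF.
have ep : phi t `^ (s + 1) = phi t `^ s * phi t.
  by rewrite powRD ?pn0 ?implybT// powRr1// ltW.
have em : phi t `^ (s - 1) = phi t `^ s / phi t.
  by rewrite powRB ?pn0 ?implybT// powRr1// ltW.
rewrite /mellin_integrand ep em !expr0 !mul1r le_eqVlt.
by apply/orP; left; apply/eqP; field; rewrite pn0 gt_eqF.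
Qed.

End MellinVariance.

(** * Second logarithmic derivatives *)

Section LogDeriv2.
Variable R : realType.
Implicit Types (A : set R) (f g : R -> R).

(** Stated as a relation carrying positivity and the intermediate first derivative, so that
    products, inverses and affine substitutions combine without side conditions. On an open set [g]
    is determined by [f], which turns functional equations into identities between second
    derivatives. *)
Definition log_deriv2 A f g := (forall x, A x -> 0 < f x) /\
  exists f1 : R -> R, forall x, A x ->
    is_derive x 1 (fun y => ln (f y)) (f1 x) /\ is_derive x 1 f1 (g x).

Lemma is_derive1_eq_on A f g (x a : R) : open A -> A x ->
  (forall y, A y -> f y = g y) -> is_derive x 1 f a -> is_derive x 1 g a.
Proof.
move=> oA Ax fg; apply: near_eq_is_derive.
exact: filterS (open_nbhs_nbhs (conj oA Ax)).
Qed.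

Lemma log_deriv2_eq A f f' g g' : open A ->
  (forall x, A x -> f x = f' x) -> (forall x, A x -> g x = g' x) ->
  log_deriv2 A f g -> log_deriv2 A f' g'.
Proof.
move=> oA ff gg [f0 [f1 H]]; split; first by move=> x Ax; rewrite -ff ?f0.
exists f1 => x Ax; have [H1 H2] := H _ Ax; split; last by rewrite -gg.
apply: (is_derive1_eq_on oA Ax _ H1) => y Ay.
by rewrite ff.
Qed.

Lemma log_deriv2_unique A f g g' : open A ->
  log_deriv2 A f g -> log_deriv2 A f g' -> forall x, A x -> g x = g' x.
Proof.
move=> oA [_ [f1 H]] [_ [f1' H']] x Ax.
have [_ H2] := H _ Ax; have [_ H2'] := H' _ Ax.
apply: is_derive1_unique H2'.
apply: (is_derive1_eq_on oA Ax _ H2) => y Ay.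
exact: (is_derive1_unique (H _ Ay).1 (H' _ Ay).1).
Qed.

Lemma log_deriv2M A f f' g g' : open A ->
  log_deriv2 A f g -> log_deriv2 A f' g' ->
  log_deriv2 A (fun x => f x * f' x) (fun x => g x + g' x).
Proof.
move=> oA [f0 [f1 H]] [f0' [f1' H']]; split.
  by move=> x Ax; rewrite mulr_gt0 ?f0 ?f0'.
exists (fun x => f1 x + f1' x) => x Ax.
have [H1 H2] := H _ Ax; have [H1' H2'] := H' _ Ax; split.
  apply: (is_derive1_eq_on oA Ax _ (is_derive1D H1 H1')) => y Ay.
  by rewrite lnM// posrE ?f0 ?f0'.
exact: is_derive1D.
Qed.

Lemma log_deriv2V A f g : open A -> log_deriv2 A f g ->
  log_deriv2 A (fun x => (f x)^-1) (fun x => - g x).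
Proof.
move=> oA [f0 [f1 H]]; split; first by move=> x Ax; rewrite invr_gt0 f0.
exists (fun x => - f1 x) => x Ax; have [H1 H2] := H _ Ax; split.
  apply: (is_derive1_eq_on oA Ax _ (is_derive1N H1)) => y Ay.
  by rewrite lnV// posrE f0.
exact: is_derive1N.
Qed.

Lemma log_deriv2_cst A (c : R) : 0 < c -> log_deriv2 A (fun=> c) (fun=> 0).
Proof.
move=> c0; split => //; exists (fun=> 0) => x Ax.
by split; exact: is_derive1_cst.
Qed.

Lemma is_derive1_affine (c b x : R) : is_derive x 1 (fun y => c * y + b) c.
Proof.
apply: (is_deriveE (is_derive1D (is_derive1M (is_derive1_cst c x) (is_derive1_id x))
  (is_derive1_cst b x))).
by rewrite mul0r add0r mulr1 addr0.
Qed.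

Lemma log_deriv2_comp A A' f g (c b : R) :
  (forall x, A' x -> A (c * x + b)) -> log_deriv2 A f g ->
  log_deriv2 A' (fun x => f (c * x + b)) (fun x => c ^+ 2 * g (c * x + b)).
Proof.
move=> AA [f0 [f1 H]]; split; first by move=> x /AA /f0.
exists (fun x => c * f1 (c * x + b)) => x /AA /H[H1 H2].
have da := is_derive1_affine c b x; split.
  apply: (is_deriveE (is_derive1_compose (f := fun y => ln (f y)) (g := fun y => c * y + b) H1 da)).
  by rewrite mulrC.
apply: (is_deriveE (is_derive1M (is_derive1_cst c x) (is_derive1_compose (g := fun y => c * y + b) H2 da))).
by rewrite mul0r add0r; ring.
Qed.

Lemma log_deriv2_id A : (forall x, A x -> 0 < x) ->
  log_deriv2 A (fun x => x) (fun x => - (x ^+ 2)^-1).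
Proof.
move=> A0; split => //; exists (fun x => x^-1) => x /A0 x0; split.
  exact: is_derive1_ln.
have xn0 : x != 0 by rewrite gt_eqF.
apply: (is_deriveE (is_derive1V xn0 (is_derive1_id x))).
by rewrite mulN1r.
Qed.

Lemma log_deriv2_affine A (c b : R) : (forall x, A x -> 0 < c * x + b) ->
  log_deriv2 A (fun x => c * x + b) (fun x => - c ^+ 2 / (c * x + b) ^+ 2).
Proof.
move=> A0; have := log_deriv2_comp A0 (log_deriv2_id (A := [set x | 0 < x]) (fun x h => h)).
rewrite (_ : (fun x => c ^+ 2 * - ((c * x + b) ^+ 2)^-1) =
  (fun x => - c ^+ 2 / (c * x + b) ^+ 2))//.
by apply/funext => x; rewrite mulNr mulrN.
Qed.

Lemma log_deriv2_of A f f1 f2 : open A -> (forall x, A x -> 0 < f x) ->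
  (forall x, A x -> is_derive x 1 f (f1 x)) ->
  (forall x, A x -> is_derive x 1 f1 (f2 x)) ->
  log_deriv2 A f (fun x => f2 x / f x - (f1 x / f x) ^+ 2).
Proof.
move=> oA f0 H1 H2; split => //.
exists (fun x => f1 x / f x) => x Ax; have fx := f0 _ Ax.
have fn0 : f x != 0 by rewrite gt_eqF.
split.
  apply: (is_deriveE (is_derive1_compose (is_derive1_ln fx) (H1 _ Ax))).
  by rewrite mulrC.
apply: (is_deriveE (is_derive1M (H2 _ Ax) (is_derive1V fn0 (H1 _ Ax)))).
by field.
Qed.

End LogDeriv2.

(** * The Gamma and trigamma functions *)

Section PowersAtInfinity.
Variable R : realType.
Implicit Types (a s t x : R).

(** Take [ln y < y] at [y = t / (2 a)] and multiply by [a]. *)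
Lemma powR_le_expR_half a t : 0 < a -> 0 < t ->
  t `^ a <= (2 * a) `^ a * expR (t / 2).
Proof.
move=> a0 t0; have a20 : 0 < 2 * a by lra.
rewrite !powRE// -expRD ler_expR.
have tp : 0 < t / (2 * a) by rewrite divr_gt0.
have := ln_sublinear tp; rewrite ln_div ?posrE// => h.
have := ler_wpM2l (ltW a0) (ltW h).
rewrite mulrBr (_ : a * (t / (2 * a)) = t / 2); first lra.
by field; rewrite gt_eqF.
Qed.

Lemma cvg_harmonic_half : (2 * (n.+1)%:R)^-1 @[n --> \oo] --> (0 : R).
Proof.
rewrite (_ : (fun n => _) = fun n => 2^-1 * harmonic n :> R); last first.
  by apply/funext => n; rewrite /harmonic/= invfM.
rewrite -(mulr0 2^-1); apply: cvgM; [exact: cvg_cst|exact: cvg_harmonic].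
Qed.

Lemma cvg_powR0_seq a (u : nat -> R) : 0 < a -> (forall n, 0 < u n) ->
  u @ \oo --> 0 -> u n `^ a @[n --> \oo] --> (0 : R).
Proof.
by move=> a0 u0 cu; move/cvg_at_rightP: (powR_cvg0 a0); apply.
Qed.

Lemma cvg_powR_expRN a : 0 < a ->
  (n.+1%:R + 1) `^ a * expR (- (n.+1%:R + 1)) @[n --> \oo] --> (0 : R).
Proof.
move=> a0; apply: (@squeeze_cvgr _ _ _ _ (fun=> 0)
  (fun n => (2 * a) `^ a * 2 * harmonic n)).
- apply: nearW => n; set b : R := n.+1%:R + 1.
  have n0 : 0 < n.+1%:R :> R by rewrite ltr0n.
  have b0 : 0 < b by rewrite /b; lra.
  rewrite mulr_ge0 ?powR_ge0 ?expR_ge0//=.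
  (* One half of the exponential absorbs the power, the other decays like [2 / n.+1]. *)
  have -> : expR (- b) = expR (- (b / 2)) * expR (- (b / 2)).
    by rewrite -expRD; congr expR; field.
  rewrite mulrA -[leRHS]mulrA; apply: ler_pM.
  + by rewrite mulr_ge0 ?powR_ge0 ?expR_ge0.
  + exact: expR_ge0.
  + by rewrite expRN ler_pdivrMr ?expR_gt0// powR_le_expR_half.
  rewrite expRN -[2 * _]invrK lef_pV2 ?posrE ?expR_gt0 ?invr_gt0 ?mulr_gt0 ?invr_gt0//.
  rewrite invfM invrK; apply: le_trans (expR_ge1Dx _).
  by rewrite /b; lra.
- exact: cvg_cst.
- rewrite -(mulr0 ((2 * a) `^ a * 2)); apply: cvgM; [exact: cvg_cst|exact: cvg_harmonic].
Qed.

End PowersAtInfinity.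

Section EulerIntegral.
Variable R : realType.
Local Notation mu := (@lebesgue_measure R).
Local Notation D := (`]0%R, +oo[%classic : set R).
Local Notation h := (fun t : R => expR (- t)).
Local Notation M := (mellin mu D idfun h).

Let aseq n : R := (2 * n.+1%:R)^-1.
Let bseq n : R := n.+1%:R + 1.

Let oD : open D. Proof. exact: interval_open. Qed.

Let mD : (R.-ocitv.-measurable).-sigma.-measurable D. Proof. exact: measurable_itv. Qed.

Let nS (n : nat) : 0 < n.+1%:R :> R. Proof. by rewrite ltr0n. Qed.

Let ab n : aseq n < bseq n.
Proof.
rewrite /aseq /bseq; apply: (@lt_trans _ _ 1); last by have := nS n; lra.
rewrite invf_lt1; have : 1 <= n.+1%:R :> R by rewrite ler1n.
all: lra.
Qed.

Let abD n : `[aseq n, bseq n] `<=` D.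
Proof.
move=> x /=; rewrite !in_itv/= => /andP[ax _]; rewrite andbT.
by apply: lt_le_trans ax; rewrite invr_gt0 mulr_gt0.
Qed.

Let exh x : D x -> \forall n \near \oo, x \in `[aseq n, bseq n].
Proof.
rewrite /= in_itv/= andbT => x0; near=> n.
have h1 : x < n.+1%:R by rewrite -truncn_le_nat; near: n; exact: nbhs_infty_ge.
have h2 : x^-1 < n.+1%:R by rewrite -truncn_le_nat; near: n; exact: nbhs_infty_ge.
rewrite in_itv/=; apply/andP; split; last by rewrite /bseq; lra.
rewrite /aseq -[x]invrK lef_pV2 ?posrE ?invr_gt0 ?mulr_gt0//.
by have := nS n; lra.
Unshelve. all: by end_near. Qed.

Let dexpN (t : R) : is_derive t 1 h (- h t).
Proof.
apply: (is_deriveE (is_derive1_compose (is_derive_expR _) (is_derive1N (is_derive1_id t)))).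
by rewrite mulrN1.
Qed.

Let measurable_expN : measurable_fun D h.
Proof.
apply: measurable_funTS; apply: continuous_measurable_fun => t.
exact: is_derive1_continuous (dexpN t).
Qed.

(* The integrand is dominated by the derivative of [- (1 + t ^ (s + 1))^-1]. *)
Lemma integrable_euler (s : R) : -1 < s ->
  mu.-integrable D (EFin \o (fun t => t `^ s * h t)).
Proof.
move=> s1; pose a := s + 1; have a0 : 0 < a by rewrite /a; lra.
pose G (t : R) := - (1 + t `^ a)^-1.
pose g (t : R) := a * t `^ s / (1 + t `^ a) ^+ 2.
have p0 t : 0 < 1 + t `^ a by rewrite ltr_wpDr ?powR_ge0.
have sE : s = a - 1 by rewrite /a addrK.
have dG t : D t -> is_derive t 1 G (g t).
  rewrite /= in_itv/= andbT => t0.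
  have dp := is_derive1D (is_derive1_cst 1 t) (is_derive1_powR a t0).
  have pn0 : 1 + t `^ a != 0 by rewrite gt_eqF.
  apply: (is_deriveE (is_derive1N (is_derive1V (f := fun t => 1 + t `^ a) pn0 dp))).
  by rewrite /g sE add0r mulNr opprK.
have cg : {in D, continuous g}.
  move=> t; rewrite inE /= in_itv/= andbT => t0.
  have dp := is_derive1D (is_derive1_cst 1 t) (is_derive1_powR a t0).
  have dp2 := is_derive1M dp dp.
  have pn0 : (1 + t `^ a) * (1 + t `^ a) != 0 by rewrite gt_eqF// mulr_gt0.
  have := is_derive1_continuous (is_derive1M (is_derive1M (is_derive1_cst a t) (is_derive1_powR s t0))
     (is_derive1V (f := fun t => (1 + t `^ a) * (1 + t `^ a)) pn0 dp2)).
  by [].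
have ig : mu.-integrable D (EFin \o g).
  apply: (integrable_bounded_primitive oD ab abD exh dG cg (M := 1)).
    by move=> t _; rewrite /g divr_ge0 ?mulr_ge0 ?powR_ge0 ?exprn_ge0// ltW.
  move=> t _; rewrite normrN ger0_norm; last by rewrite invr_ge0 ltW.
  by rewrite invf_le1// lerDl powR_ge0.
pose B := (2 * a) `^ a.
have B0 : 0 <= B by exact: powR_ge0.
(* The constant comes from [1 + t ^ a <= (1 + B) e ^ (t / 2)]: squared, it gives
   [t ^ s e ^ (- t) <= (1 + B) ^ 2 / a * g t]. *)
have iKg := integrableZl mD ((1 + B) ^+ 2 / a) ig.
apply: le_integrable iKg.
- exact: mD.
- apply/measurable_EFinP; apply: measurable_funM.
    exact: (measurableT_comp (measurable_powR s)).
  exact: measurable_expN.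
move=> t; rewrite /= in_itv/= andbT => t0.
rewrite lee_fin !ger0_norm; last 2 first.
- by rewrite mulr_ge0 ?divr_ge0 ?sqr_ge0 ?mulr_ge0 ?powR_ge0// ltW.
- by rewrite mulr_ge0 ?powR_ge0 ?expR_ge0.
rewrite /g (_ : (1 + B) ^+ 2 / a * (a * t `^ s / (1 + t `^ a) ^+ 2) =
   t `^ s * ((1 + B) ^+ 2 / (1 + t `^ a) ^+ 2)); last first.
  by field; rewrite !gt_eqF.
rewrite ler_wpM2l ?powR_ge0// ler_pdivlMr ?exprn_gt0// expRN mulrC ler_pdivrMr ?expR_gt0//.
have -> : expR t = expR (t / 2) ^+ 2 by rewrite expr2 -expRD; congr expR; field.
rewrite -exprMn lerXn2r ?nnegrE ?mulr_ge0 ?expR_ge0//; [exact: ltW|lra|].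
rewrite mulrDl mul1r; apply: lerD; last exact: powR_le_expR_half.
have : 1 + t / 2 <= expR (t / 2) := expR_ge1Dx _.
lra.
Qed.

Lemma euler_integralE (x : R) : euler_integral x = M 0 (x - 1).
Proof.
by apply: eq_Rintegral => t _; rewrite /mellin_integrand expr0 mul1r.
Qed.

Lemma euler_integralS (x : R) : 0 < x -> euler_integral (x + 1) = x * euler_integral x.
Proof.
move=> x0; pose G (t : R) := t `^ x * h t.
pose g (t : R) := x * (t `^ (x - 1) * h t) - t `^ x * h t.
have x1 : -1 < x - 1 by lra.
have i0 := integrable_euler x1.
have i1 : mu.-integrable D (EFin \o (fun t => x * (t `^ (x - 1) * h t))).
  by apply: eq_integrable (integrableZl mD x (integrable_euler x1)) => //;
    exact: mD.
have i2 : mu.-integrable D (EFin \o (fun t => t `^ x * h t)).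
  by apply: integrable_euler; lra.
have ig : mu.-integrable D (EFin \o g).
  by apply: eq_integrable (integrableB mD i1 i2) => //;
    exact: mD.
have dG t : D t -> is_derive t 1 G (g t).
  rewrite /= in_itv/= andbT => t0.
  apply: (is_deriveE (is_derive1M (is_derive1_powR x t0) (dexpN t))).
  by rewrite /g /=; ring.
have cg : {in D, continuous g}.
  move=> t; rewrite inE /= in_itv/= andbT => t0.
  have p1 := is_derive1M (is_derive1_powR (x - 1) t0) (dexpN t).
  have p2 := is_derive1M (is_derive1_powR x t0) (dexpN t).
  exact: is_derive1_continuous (is_derive1B (is_derive1M (is_derive1_cst x t) p1) p2).
have := improper_FTC2 oD ab abD exh dG cg (la := 0) (lb := 0) ig.
rewrite subrr => H; apply/eqP; rewrite -subr_eq0 -oppr_eq0 opprB; apply/eqP.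
rewrite -[RHS]H.
- rewrite (RintegralB mD i1 i2) (RintegralZl x mD i0).
  by rewrite /euler_integral addrK.
- apply: (@squeeze_cvgr _ _ _ _ (fun=> 0) (fun n => aseq n `^ x)).
  + apply: nearW => n; rewrite mulr_ge0 ?powR_ge0 ?expR_ge0//= ler_piMr ?powR_ge0//.
    by rewrite expR_le1 oppr_le0 invr_ge0 mulr_ge0 ?ler0n.
  + exact: cvg_cst.
  + apply: cvg_powR0_seq => //; last exact: cvg_harmonic_half.
    by move=> n; rewrite invr_gt0 mulr_gt0.
- exact: cvg_powR_expRN.
Qed.

End EulerIntegral.

Section Trigamma.
Variable R : realType.
Local Notation mu := (@lebesgue_measure R).
Local Notation D := (`]0%R, +oo[%classic : set R).
Local Notation h := (fun t : R => expR (- t)).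
Local Notation M := (mellin mu D idfun h).

Let mD : (R.-ocitv.-measurable).-sigma.-measurable D.
Proof. exact: measurable_itv. Qed.

Let D_gt0 t : D t -> 0 < idfun t.
Proof. by rewrite /= in_itv/= andbT. Qed.

Let mid : measurable_fun D (idfun : R -> R). Proof. exact: measurable_id. Qed.

Let mh : measurable_fun D h.
Proof.
apply: measurable_funTS; apply: continuous_measurable_fun => t.
exact: (is_derive1_continuous (is_derive1_compose (is_derive_expR _) (is_derive1N (is_derive1_id t)))).
Qed.

Lemma euler_integral_gt0 (x : R) : 0 < x -> 0 < euler_integral x.
Proof.
move=> x0; have D0 : mu D != 0%E by rewrite lebesgue_measure_itv /= ltry.
apply: (Rintegral_gt0 mD D0).
- by apply: integrable_euler; lra.
- by move=> t /D_gt0 /= t0; rewrite mulr_gt0 ?powR_gt0 ?expR_gt0.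
Qed.

(** For [0 < x] this is the trigamma function, as the variance of [ln t] under the Gamma density of
    shape [x]; the shift is that of [euler_integral x = M 0 (x - 1)]. Sign and decay are immediate
    in this form. *)
Definition etrigamma (x : R) := mellin_var mu D idfun h (x - 1).

Let M_gt0 (s : R) : -1 < s -> 0 < M 0 s.
Proof.
by move=> s1; rewrite -[s](addrK 1) -euler_integralE euler_integral_gt0//; lra.
Qed.

Let h_ge0 (t : R) : D t -> 0 <= h t. Proof. by move=> _; exact: expR_ge0. Qed.

Let oA (a : R) : open [set x : R | a < x]. Proof. exact: open_gt. Qed.

Let dM k (s : R) : -1 < s -> is_derive s 1 (M k) (M k.+1 s).
Proof. exact: (is_derive_mellin mD mid mh D_gt0 (@integrable_euler R)). Qed.

Lemma log_deriv2_euler : log_deriv2 [set x : R | 0 < x] (@euler_integral R) etrigamma.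
Proof.
have H : log_deriv2 [set s : R | -1 < s] (M 0) (mellin_var mu D idfun h).
  exact: (log_deriv2_of (@oA _) M_gt0 (dM 0%N) (dM 1%N)).
have AA x : 0 < x -> [set s : R | -1 < s] (1 * x + -1) by rewrite /=; lra.
apply: log_deriv2_eq (log_deriv2_comp (A' := [set x | 0 < x]) AA H) => //.
- by move=> x _ /=; rewrite mul1r euler_integralE.
- by move=> x _ /=; rewrite expr1n !mul1r.
Qed.

Let is_derive_shift (f : R -> R) (a x : R) : is_derive (x - 1) 1 f a ->
  is_derive x 1 (fun y => f (y - 1)) a.
Proof.
move=> df; have d := is_derive1B (is_derive1_id x) (is_derive1_cst 1 x).
apply: (is_deriveE (is_derive1_compose (g := fun y => y - 1) df d)).
by rewrite subr0 mulr1.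
Qed.

Lemma derivable_euler (x : R) : 0 < x -> derivable (@euler_integral R) x 1.
Proof.
move=> x0; have s1 : -1 < x - 1 by lra.
rewrite (_ : @euler_integral R = fun y => M 0 (y - 1)).
  exact: (@ex_derive _ _ _ _ _ _ _ (is_derive_shift (dM 0 s1))).
by apply/funext => y; exact: euler_integralE.
Qed.

Lemma derivable_etrigamma (x : R) : 0 < x -> derivable etrigamma x 1.
Proof.
move=> x0; have s1 : -1 < x - 1 by lra.
have m0 : M 0 (x - 1) != 0 by rewrite gt_eqF// M_gt0.
have dV := is_derive1V m0 (dM 0 s1).
have dq := is_derive1M (dM 1 s1) dV.
have d := is_derive1B (is_derive1M (dM 2 s1) dV) (is_derive1M dq dq).
apply: (@ex_derive _ _ _ _ _ _ _ (is_derive_shift (f := fun s => M 2 s * (M 0 s)^-1 -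
  M 1 s * (M 0 s)^-1 * (M 1 s * (M 0 s)^-1)) d)).
Qed.

Lemma etrigamma_rec (x : R) : 0 < x -> etrigamma x = etrigamma (x + 1) + (x ^+ 2)^-1.
Proof.
move=> x0.
have AA y : 0 < y -> [set s : R | 0 < s] (1 * y + 1) by rewrite /=; lra.
have H1 := log_deriv2_comp (A' := [set x | 0 < x]) AA log_deriv2_euler.
have H2 := log_deriv2M (@oA _) (log_deriv2_id (A := [set x | 0 < x]) (fun x h => h))
  log_deriv2_euler.
have H3 : log_deriv2 [set x | 0 < x] (fun x => euler_integral (1 * x + 1))
    (fun x => - (x ^+ 2)^-1 + etrigamma x).
  apply: log_deriv2_eq H2 => // y y0.
  by rewrite mul1r euler_integralS.
have := log_deriv2_unique (@oA _) H1 H3 x0.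
rewrite expr1n !mul1r => ->; lra.
Qed.

Lemma etrigamma_ge0 (x : R) : 0 < x -> 0 <= etrigamma x.
Proof.
move=> x0; apply: (mellin_var_ge0 mD mid mh D_gt0 (@integrable_euler R) h_ge0 M_gt0).
by lra.
Qed.

(** [mellin_var_le] at [s = a = x - 1]: the functional equation evaluates the bracket divided by
    [M 0 s] as [x / (x - 1) - 2 + 1]. *)
Lemma etrigamma_le (x : R) : 1 < x -> etrigamma x <= 4 / (x - 1).
Proof.
move=> x1; have x10 : 0 < x - 1 by lra.
have x0 : 0 < x by lra.
have x11 : -1 < x - 1 - 1 by lra.
apply: le_trans (mellin_var_le mD mid mh D_gt0 (@integrable_euler R) h_ge0 M_gt0 x10 x10) _.
have e2 : M 0 (x - 1) = (x - 1) * M 0 (x - 1 - 1).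
  by rewrite -!euler_integralE -(euler_integralS x10) subrK.
have e1 : M 0 (x - 1 + 1) = x * M 0 (x - 1).
  by rewrite subrK -euler_integralE -(euler_integralS x0) euler_integralE addrK.
have := M_gt0 x11; rewrite e1 e2; move: (M 0 (x - 1 - 1)) => m m0.
rewrite le_eqVlt; apply/orP; left; apply/eqP.
by field; rewrite !gt_eqF.
Qed.

Lemma log_deriv2_derive1n A (f g : R -> R) (x : R) : open A -> log_deriv2 A f g ->
  A x -> derive1n 2 (fun y => ln (f y)) x = g x.
Proof.
move=> oA' [_ [f1 H]] Ax; rewrite /derive1n /= derive1E.
apply: derive_val; have [_ H2] := H _ Ax.
apply: (is_derive1_eq_on oA' Ax _ H2) => y /H[H1 _].
by rewrite derive1E; apply/esym; apply: derive_val.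
Qed.

(** The range [-1 < x] covers [2 l] for every admissible [l], so both branches of [Gamma] are
    brought to one expression in Euler's integral at a positive argument. *)
Lemma Gamma_shift (x : R) : -1 < x -> x != 0 -> Gamma x = euler_integral (x + 1) / x.
Proof.
move=> x1 x0; rewrite /Gamma; case: ifPn => [xp|].
  by rewrite euler_integralS// mulrAC mulfV// mul1r.
rewrite -leNgt => xn; have xlt : x < 0 by rewrite lt_neqAle x0.
have -> : Num.truncn (- x) = 0%N.
  by apply/eqP; rewrite -leqn0 truncn_le_nat; lra.
by rewrite big_ord1 addr0.
Qed.

(** Differentiates [ln |Gamma x| = ln (euler_integral (x + 1)) - ln |x|] twice. The intervals on the
    two sides of the pole at 0 are treated separately, each being open with [|x|] affine there. *)
Lemma trigammaE (x : R) : -1 < x -> x != 0 -> trigamma x = etrigamma (x + 1) + (x ^+ 2)^-1.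
Proof.
move=> x1 x0.
have oN : open [set x : R | -1 < x < 0].
  rewrite (_ : [set _ | _] = [set x : R | -1 < x] `&` [set x : R | x < 0]).
    by apply: openI; [exact: open_gt|exact: open_lt].
  by apply/seteqP; split => y /= /andP.
have [xp|xn] := ltP 0 x.
  have AA y : 0 < y -> [set s : R | 0 < s] (1 * y + 1) by rewrite /=; lra.
  have H1 := log_deriv2_comp (A' := [set x | 0 < x]) AA log_deriv2_euler.
  have H2 := log_deriv2V (@oA _) (log_deriv2_id (A := [set x | 0 < x]) (fun x h => h)).
  have H : log_deriv2 [set x | 0 < x] (fun x => `|Gamma x|) (fun x => etrigamma (x + 1) + (x ^+ 2)^-1).
    apply: log_deriv2_eq (log_deriv2M (@oA _) H1 H2) => // y /= y0.
      rewrite Gamma_shift ?gt_eqF//; last lra.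
      by rewrite ger0_norm ?mul1r// divr_ge0// ltW// euler_integral_gt0//; lra.
    by rewrite expr1n !mul1r opprK.
  exact: (log_deriv2_derive1n (@oA _) H xp).
have {}xn : -1 < x < 0 by rewrite x1 lt_neqAle x0.
have AA y : -1 < y < 0 -> [set s : R | 0 < s] (1 * y + 1) by rewrite /=; lra.
have H1 := log_deriv2_comp (A' := [set x : R | -1 < x < 0]) AA log_deriv2_euler.
have A0 y : [set x : R | -1 < x < 0] y -> 0 < -1 * y + 0 by rewrite /=; lra.
have H2 := log_deriv2V oN (log_deriv2_affine A0).
have H : log_deriv2 [set x : R | -1 < x < 0] (fun x => `|Gamma x|) (fun x => etrigamma (x + 1) + (x ^+ 2)^-1).
  apply: log_deriv2_eq (log_deriv2M oN H1 H2) => // y /= /andP[y1 y0].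
    rewrite Gamma_shift ?lt_eqF// normrM normfV (ltr0_norm y0) mul1r addr0 mulN1r.
    by rewrite gtr0_norm// euler_integral_gt0//; lra.
  by rewrite expr1n !mul1r addr0 mulN1r !sqrrN expr1n mulN1r opprK.
exact: (log_deriv2_derive1n oN H xn).
Qed.

End Trigamma.

(** * Moments of the Gegenbauer weight *)

Lemma le0_of_inv_decay (R : realType) (e b C : R) : 0 <= C ->
  (forall n, 0 < b + n%:R -> e <= C / (b + n%:R)) -> e <= 0.
Proof.
move=> C0 H; rewrite leNgt; apply/negP => e0.
pose n := (Num.truncn (C / e + `|b|)).+1.
have n1 : C / e + `|b| < n%:R by exact: truncnS_gt.
have b1 : - `|b| <= b by rewrite lerNl -normrN ler_norm.
have d0 : 0 <= C / e by rewrite divr_ge0// ltW.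
have bn : 0 < b + n%:R by lra.
have := H _ bn; rewrite ler_pdivlMr// => h.
have : e * (C / e) < e * (b + n%:R) by rewrite ltr_pM2l//; lra.
by rewrite mulrCA mulfV ?gt_eqF// mulr1 ltNge h.
Qed.

Section GegenbauerMoments.
Variable R : realType.
Local Notation mu := (@lebesgue_measure R).
Local Notation D := (`](-1)%R, 1%R[%classic : set R).
Local Notation phi := (fun x : R => 1 - x ^+ 2).
Implicit Types (p q : {poly R}) (s l : R).

Let mD : (R.-ocitv.-measurable).-sigma.-measurable D.
Proof. exact: measurable_itv. Qed.

Let oD : open D. Proof. exact: interval_open. Qed.

Let DP x : D x -> -1 < x < 1. Proof. by rewrite /= in_itv. Qed.

Lemma one_sub_sqr_gt0 (x : R) : D x -> 0 < phi x.
Proof.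
move=> /DP x1; rewrite (_ : 1 - x ^+ 2 = (1 - x) * (1 + x)); last by ring.
by apply: mulr_gt0; lra.
Qed.

Let dphi (x : R) : is_derive x 1 phi (- (2 * x)).
Proof.
have := is_derive1B (is_derive1_cst 1 x) (is_derive1M (is_derive1_id x) (is_derive1_id x)).
rewrite (_ : (fun y : R => 1 - y * y) = phi); last by apply/funext => y; rewrite expr2.
by move=> H; apply: (is_deriveE H); ring.
Qed.

Let mphi : measurable_fun D phi.
Proof.
apply: measurable_funTS; apply: continuous_measurable_fun => x.
exact: (is_derive1_continuous (dphi x)).
Qed.

Let continuous_horner p : continuous (fun x => p.[x]).
Proof. by move=> x; exact: (is_derive1_continuous (is_derive_poly p x)). Qed.

Let measurable_horner p : measurable_fun D (fun x => p.[x]).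
Proof. by apply: measurable_funTS; exact: continuous_measurable_fun. Qed.

Let eps n : R := (2 * n.+1%:R)^-1.
Let bseq n : R := 1 - eps n.
Let aseq n : R := - bseq n.

Let eps_gt0 n : 0 < eps n.
Proof. by rewrite invr_gt0 mulr_gt0// ltr0n. Qed.

Let eps_le n : eps n <= 2^-1.
Proof. by rewrite lef_pV2 ?posrE ?mulr_gt0 ?ltr0n// ler_peMr// ler1n. Qed.

Let ab n : aseq n < bseq n.
Proof. by rewrite /aseq /bseq; have := eps_le n; lra. Qed.

Let abD n : `[aseq n, bseq n] `<=` D.
Proof.
move=> x /=; rewrite !in_itv/= /aseq /bseq => /andP[ax xb].
by have := eps_gt0 n; lra.
Qed.

Let exh x : D x -> \forall n \near \oo, x \in `[aseq n, bseq n].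
Proof.
move=> /DP/andP[x0 x1]; near=> n.
have pN : 0 < n.+1%:R :> R by rewrite ltr0n.
have h1 : (1 - x)^-1 < n.+1%:R by rewrite -truncn_le_nat; near: n; exact: nbhs_infty_ge.
have h2 : (1 + x)^-1 < n.+1%:R by rewrite -truncn_le_nat; near: n; exact: nbhs_infty_ge.
have g1 : eps n <= 1 - x.
  by rewrite /eps -[leRHS]invrK lef_pV2 ?posrE ?invr_gt0 ?mulr_gt0//; lra.
have g2 : eps n <= 1 + x.
  by rewrite /eps -[leRHS]invrK lef_pV2 ?posrE ?invr_gt0 ?mulr_gt0//; lra.
by rewrite in_itv/= /aseq /bseq; lra.
Unshelve. all: by end_near. Qed.

Let d1p (a x : R) : D x -> is_derive x 1 (fun x => (1 + x) `^ a) (a * (1 + x) `^ (a - 1)).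
Proof.
move=> /DP x1; have x0 : 0 < 1 + x by lra.
have d := is_derive1D (is_derive1_cst 1 x) (is_derive1_id x).
apply: (is_deriveE (is_derive1_compose (f := fun t => t `^ a) (g := fun x => 1 + x) (is_derive1_powR a x0) d)).
by rewrite add0r mulr1.
Qed.

Let d1m (a x : R) : D x -> is_derive x 1 (fun x => (1 - x) `^ a) (- (a * (1 - x) `^ (a - 1))).
Proof.
move=> /DP x1; have x0 : 0 < 1 - x by lra.
have d := is_derive1B (is_derive1_cst 1 x) (is_derive1_id x).
apply: (is_deriveE (is_derive1_compose (f := fun t => t `^ a) (g := fun x => 1 - x) (is_derive1_powR a x0) d)).
by rewrite sub0r mulrN1.
Qed.

Let dphip (a x : R) : D x ->
  is_derive x 1 (fun x => phi x `^ a) (a * phi x `^ (a - 1) * - (2 * x)).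
Proof.
move=> Dx; have x0 := one_sub_sqr_gt0 Dx.
exact: (is_derive1_compose (f := fun t => t `^ a) (g := phi) (is_derive1_powR a x0) (dphi x)).
Qed.

(** Since [phi x = (1 + x) (1 - x)] lies between the smaller and the larger of [1 - x] and [1 + x],
    its power is dominated by one of the two powers, whatever the sign of [s]. The sum has an
    elementary antiderivative. *)
Let powR_le_sum (s x : R) : D x -> phi x `^ s <= (1 + x) `^ s + (1 - x) `^ s.
Proof.
move=> Dx; have px := one_sub_sqr_gt0 Dx; have /andP[x0 x1] := DP Dx.
have pp : 0 < 1 + x by lra.
have pm : 0 < 1 - x by lra.
have e : phi x = (1 + x) * (1 - x) by ring.
have key (u v : R) : 0 < u -> 0 < v -> (0 <= s -> u <= v) -> (s < 0 -> v <= u) ->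
    u `^ s <= v `^ s.
  move=> u0 v0 h1 h2; rewrite !powRE// ler_expR.
  have [sp|sn] := leP 0 s.
    by rewrite ler_wpM2l// ler_ln ?posrE// h1.
  by rewrite ler_wnM2l ?(ltW sn)// ler_ln ?posrE// h2.
have := powR_ge0 (1 + x) s; have := powR_ge0 (1 - x) s.
have [xp|xn] := leP 0 x; have [sp|sn] := leP 0 s.
- suff : phi x `^ s <= (1 + x) `^ s by lra.
  by apply: key => //; lra || nra.
- suff : phi x `^ s <= (1 - x) `^ s by lra.
  by apply: key => //; lra || nra.
- suff : phi x `^ s <= (1 - x) `^ s by lra.
  by apply: key => //; lra || nra.
- suff : phi x `^ s <= (1 + x) `^ s by lra.
  by apply: key => //; lra || nra.
Qed.

Let horner_bound p : exists2 K, 0 <= K & forall x, D x -> `|p.[x]| <= K.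
Proof.
exists (\sum_(i < size p) `|p`_i|); first by apply: sumr_ge0.
move=> x /DP x1; rewrite horner_coef; apply: le_trans (ler_norm_sum _ _ _) _.
apply: ler_sum => i _; rewrite normrM ler_piMr// normrX exprn_ile1//.
by rewrite ler_norml; lra.
Qed.

(** The majorant is a multiple of the derivative of [(1 + x) ^ a - (1 - x) ^ a] with
    [a = s + 1 > 0], which is bounded on the interval; the polynomial factor is bounded as well. *)
Lemma integrable_weight p s : -1 < s ->
  mu.-integrable D (EFin \o (fun x => phi x `^ s * p.[x])).
Proof.
move=> s1; pose a := s + 1; have a0 : 0 < a by rewrite /a; lra.
pose G (x : R) := (1 + x) `^ a - (1 - x) `^ a.
pose g (x : R) := a * (1 + x) `^ s + a * (1 - x) `^ s.
have sE : s = a - 1 by rewrite /a addrK.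
have dG x : D x -> is_derive x 1 G (g x).
  move=> Dx; apply: (is_deriveE (is_derive1B (d1p a Dx) (d1m a Dx))).
  by rewrite /g sE opprK.
have cg : {in D, continuous g}.
  move=> x /set_mem Dx.
  exact: (is_derive1_continuous (is_derive1D (is_derive1M (is_derive1_cst a x) (d1p s Dx))
    (is_derive1M (is_derive1_cst a x) (d1m s Dx)))).
have ig : mu.-integrable D (EFin \o g).
  apply: (integrable_bounded_primitive oD ab abD exh dG cg (M := 2 `^ a + 2 `^ a)).
    by move=> x _; rewrite /g addr_ge0// mulr_ge0 ?powR_ge0// ltW.
  move=> x /DP x1; apply: le_trans (ler_normB _ _) _.
  rewrite !ger0_norm ?powR_ge0//; apply: lerD; apply: ge0_ler_powR;
    rewrite ?nnegrE; lra.
have [K K0 pK] := horner_bound p.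
have iKg := integrableZl mD (K / a) ig.
apply: le_integrable iKg.
- exact: mD.
- apply/measurable_EFinP; apply: measurable_funM.
    exact: (measurableT_comp (measurable_powR s)).
  exact: measurable_horner.
move=> x Dx; rewrite /= lee_fin normrM [`|_ `^ _|]ger0_norm ?powR_ge0//.
apply: le_trans (ler_norm _); rewrite /g.
apply: (@le_trans _ _ (phi x `^ s * K)).
  by rewrite ler_wpM2l ?powR_ge0 ?pK.
rewrite (_ : K / a * _ = K * ((1 + x) `^ s + (1 - x) `^ s)); last first.
  by field; rewrite gt_eqF.
by rewrite mulrC ler_wpM2l// powR_le_sum.
Qed.

(** The [k]-th derivative in [l] of the moment functional of the weight, for a fixed polynomial.
    [gmoment 0 l (p * q)] is the inner product. *)
Definition gmoment k l p := mellin mu D phi (fun x => p.[x]) k (l - 2^-1).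

Let gint k l p := mellin_integrand phi (fun x => p.[x]) k (l - 2^-1).

Lemma integrable_gmoment k l p : - 2^-1 < l -> mu.-integrable D (EFin \o gint k l p).
Proof.
move=> l1; apply: integrable_mellin => //.
- exact: measurable_horner.
- exact: one_sub_sqr_gt0.
- by move=> s; exact: integrable_weight.
- by lra.
Qed.

Lemma gmomentD k l p q : - 2^-1 < l -> gmoment k l (p + q) = gmoment k l p + gmoment k l q.
Proof.
move=> l1; rewrite /gmoment /mellin -RintegralD//; try exact: integrable_gmoment.
by apply: eq_Rintegral => x _; rewrite /mellin_integrand hornerD mulrDr.
Qed.

Lemma gmomentZ k l (a : R) p : - 2^-1 < l -> gmoment k l (a *: p) = a * gmoment k l p.
Proof.
move=> l1; rewrite /gmoment /mellin -RintegralZl//; last exact: integrable_gmoment.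
by apply: eq_Rintegral => x _; rewrite /mellin_integrand hornerZ mulrCA.
Qed.

Lemma is_derive_gmoment k l p : - 2^-1 < l ->
  is_derive l 1 (fun l => gmoment k l p) (gmoment k.+1 l p).
Proof.
move=> l1; have s1 : -1 < l - 2^-1 by lra.
have H := is_derive_mellin mD mphi (measurable_horner p) one_sub_sqr_gt0
  (fun s => @integrable_weight p s) k s1.
have d := is_derive1B (is_derive1_id l) (is_derive1_cst 2^-1 l).
apply: (is_deriveE (is_derive1_compose (g := fun l => l - 2^-1) H d)).
by rewrite subr0 mulr1.
Qed.

Lemma gmoment_shift l p : - 2^-1 < l ->
  gmoment 0 (l + 1) p = gmoment 0 l ((1 - 'X^2) * p).
Proof.
move=> l1; apply: eq_Rintegral => x /set_mem Dx; have px := one_sub_sqr_gt0 Dx.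
rewrite /mellin_integrand !expr0 !mul1r hornerM hornerD hornerN hornerXn hornerC.
rewrite mulrA; congr (_ * _).
have -> : l + 1 - 2^-1 = l - 2^-1 + 1 by lra.
by rewrite powRD ?(gt_eqF px) ?implybT// powRr1// ltW.
Qed.

(** The argument times the weight is the derivative of [q (1 - x ^ 2) ^ (l + 1 / 2)], which vanishes
    at both endpoints because the exponent is positive. *)
Lemma gmoment_ibp l q : - 2^-1 < l ->
  gmoment 0 l ((1 - 'X^2) * q^`() - (2 * l + 1) *: ('X * q)) = 0.
Proof.
move=> l1; pose a := l + 2^-1; have a0 : 0 < a by rewrite /a; lra.
pose r := (1 - 'X^2) * q^`() - (2 * l + 1) *: ('X * q).
pose G (x : R) := q.[x] * phi x `^ a.
have aE : l - 2^-1 = a - 1 by rewrite /a; lra.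
have s1 : -1 < l - 2^-1 by lra.
pose g (x : R) := phi x `^ (l - 2^-1) * r.[x].
have dG x : D x -> is_derive x 1 G (g x).
  move=> Dx; have px := one_sub_sqr_gt0 Dx.
  apply: (is_deriveE (is_derive1M (is_derive_poly q x) (dphip a Dx))).
  have -> : phi x `^ a = phi x `^ (l - 2^-1) * phi x.
    by rewrite -[X in _ * X]powRr1 ?ltW// -powRD ?(gt_eqF px) ?implybT//; congr (_ `^ _); rewrite /a; lra.
  have -> : g x = phi x `^ (l - 2^-1) * (phi x * q^`().[x] - (2 * l + 1) * (x * q.[x])).
    by rewrite /g /r hornerD hornerN hornerZ !hornerM hornerD hornerN hornerXn hornerC hornerX.
  rewrite -aE; move: (_ `^ _) => P; by rewrite /a; field.
have cg : {in D, continuous g}.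
  move=> x /set_mem Dx.
  exact: is_derive1_continuous (is_derive1M (dphip (l - 2^-1) Dx) (is_derive_poly r x)).
have [K K0 qK] := horner_bound q.
have bD n : D (bseq n).
  by apply: (abD (n := n)); rewrite /= in_itv/= lexx (ltW (ab n)).
have aD n : D (aseq n).
  by apply: (abD (n := n)); rewrite /= in_itv/= lexx (ltW (ab n)).
have pb n : phi (aseq n) = phi (bseq n) by rewrite /aseq sqrrN.
have cpb : phi (bseq n) `^ a @[n --> \oo] --> (0 : R).
  apply: cvg_powR0_seq => //; first by move=> n; exact: one_sub_sqr_gt0.
  rewrite (_ : (fun n => _) = fun n => eps n * (2 - eps n)); last first.
    by apply/funext => n; rewrite /bseq; ring.
  rewrite -(mul0r (2 - 0 : R)); apply: cvgM; first exact: cvg_harmonic_half.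
  by apply: cvgB; [exact: cvg_cst|exact: cvg_harmonic_half].
have cG (u : nat -> R) : (forall n, D (u n)) -> (forall n, phi (u n) = phi (bseq n)) ->
    G (u n) @[n --> \oo] --> (0 : R).
  move=> Du pu; apply/norm_cvg0P.
  apply: (@squeeze_cvgr _ _ _ _ (fun=> 0) (fun n => K * phi (bseq n) `^ a)).
  - apply: nearW => n; rewrite normr_ge0/= normrM [`|_ `^ _|]ger0_norm ?powR_ge0// pu.
    by rewrite ler_wpM2r ?powR_ge0 ?qK.
  - exact: cvg_cst.
  - by rewrite -(mulr0 K); apply: cvgM => //; exact: cvg_cst.
have := improper_FTC2 oD ab abD exh dG cg (la := 0) (lb := 0) (integrable_weight r s1).
rewrite subrr => H.
rewrite -[RHS]H; [|exact: cG|exact: cG].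
by apply: eq_Rintegral => x _; rewrite /mellin_integrand expr0 mul1r.
Qed.

Lemma gmoment1_gt0 l : - 2^-1 < l -> 0 < gmoment 0 l 1.
Proof.
move=> l1; have D0 : mu D != 0%E.
  by rewrite lebesgue_measure_itv /= lte_fin ifT ?gt_eqF ?lte_fin//; lra.
apply: (Rintegral_gt0 mD D0); first exact: integrable_gmoment.
move=> x Dx; rewrite /mellin_integrand expr0 mul1r hornerC mulr1 powR_gt0//.
exact: one_sub_sqr_gt0.
Qed.

(** Integration by parts with [q = 'X], after writing [(1 - X ^ 2) - (2 l + 1) X ^ 2] as
    [(2 l + 2) (1 - X ^ 2) - (2 l + 1)]. *)
Lemma gmoment1_rec l : - 2^-1 < l ->
  gmoment 0 (l + 1) 1 = (l + 2^-1) / (l + 1) * gmoment 0 l 1.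
Proof.
move=> l1; have l0 : 0 < l + 1 by lra.
have ln0 : l + 1 != 0 by rewrite gt_eqF.
have := gmoment_ibp 'X l1.
have -> : (1 - 'X^2) * ('X : {poly R})^`() - (2 * l + 1) *: ('X * 'X) =
    (2 * l + 2) *: ((1 - 'X^2) * 1) + (- (2 * l + 1)) *: (1 : {poly R}).
  by rewrite derivX -!mul_polyC !rmorphN !rmorphD/=; ring.
rewrite gmomentD// !gmomentZ// -gmoment_shift//.
move: (gmoment 0 (l + 1) 1) (gmoment 0 l 1) => u v H.
by apply: (mulfI ln0); rewrite [RHS]mulrA (mulrC (l + 1) (_ / _)) divfK//; lra.
Qed.

Let gv l := mellin_var mu D phi (fun x => (1 : {poly R}).[x]) (l - 2^-1).

Let mellin_gt0 s : -1 < s -> 0 < mellin mu D phi (fun x => (1 : {poly R}).[x]) 0 s.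
Proof.
move=> s1; have l1 : - 2^-1 < s + 2^-1 by lra.
by have := gmoment1_gt0 l1; rewrite /gmoment addrK.
Qed.

Let h_ge0 (x : R) : D x -> 0 <= (1 : {poly R}).[x].
Proof. by rewrite hornerC. Qed.

Let oA : open [set l : R | - 2^-1 < l]. Proof. exact: open_gt. Qed.

Let log_deriv2_gv : log_deriv2 [set l | - 2^-1 < l] (fun l => gmoment 0 l 1) gv.
Proof.
rewrite /gv /mellin_var.
have H := (log_deriv2_of (f := fun l => gmoment 0 l 1) (f1 := fun l => gmoment 1 l 1)
  (f2 := fun l => gmoment 2 l 1) (@oA) (@gmoment1_gt0)
  (fun l hl => @is_derive_gmoment 0%N l 1 hl)
  (fun l hl => @is_derive_gmoment 1%N l 1 hl)).
exact: H.
Qed.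

Let gv_rec l : - 2^-1 < l ->
  gv l = gv (l + 1) + ((l + 2^-1) ^+ 2)^-1 - ((l + 1) ^+ 2)^-1.
Proof.
move=> l1.
have AA y : - 2^-1 < y -> [set s : R | - 2^-1 < s] (1 * y + 1) by rewrite /=; lra.
have H1 := log_deriv2_comp (A' := [set l | - 2^-1 < l]) AA log_deriv2_gv.
have p1 y : [set l : R | - 2^-1 < l] y -> 0 < 1 * y + 2^-1 by rewrite /=; lra.
have p2 y : [set l : R | - 2^-1 < l] y -> 0 < 1 * y + 1 by rewrite /=; lra.
have H2 := log_deriv2M (@oA) (log_deriv2M (@oA) (log_deriv2_affine p1)
  (log_deriv2V (@oA) (log_deriv2_affine p2))) log_deriv2_gv.
have H3 : log_deriv2 [set l | - 2^-1 < l] (fun l => gmoment 0 (1 * l + 1) 1)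
    (fun l => - ((l + 2^-1) ^+ 2)^-1 + ((l + 1) ^+ 2)^-1 + gv l).
  apply: log_deriv2_eq H2 => // y y0 /=; rewrite !mul1r; first by rewrite gmoment1_rec.
  by rewrite expr1n !mulN1r opprK.
have := log_deriv2_unique oA H1 H3 l1.
by rewrite expr1n !mul1r => ->; lra.
Qed.

Let gv_ge0 l : - 2^-1 < l -> 0 <= gv l.
Proof.
move=> l1; apply: (mellin_var_ge0 mD mphi (measurable_horner 1) one_sub_sqr_gt0
  (fun s => @integrable_weight 1 s) h_ge0 mellin_gt0); lra.
Qed.

(** [mellin_var_le] with [a = 1], the value of [1 - x ^ 2] at 0, around which the weight
    concentrates for large [l]. The moment ratios give exactly [2 / (l - 1 / 2) - 2 / (l + 1)]. *)
Let gv_le l : 2^-1 < l -> gv l <= 2 / (l - 2^-1).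
Proof.
move=> l1; have l0 : 0 < l - 2^-1 by lra.
apply: (le_trans (mellin_var_le mD mphi (measurable_horner 1) one_sub_sqr_gt0
  (fun s => @integrable_weight 1 s) h_ge0 mellin_gt0 l0 ltr01)).
have l1' : - 2^-1 < l - 1 by lra.
have l2' : - 2^-1 < l by lra.
have -> : l - 2^-1 + 1 = l + 1 - 2^-1 by lra.
have -> : l - 2^-1 - 1 = l - 1 - 2^-1 by lra.
rewrite -!/(gmoment _ _ _) gmoment1_rec//.
have -> : gmoment 0 l 1 = (l - 1 + 2^-1) / l * gmoment 0 (l - 1) 1.
  by rewrite -[in LHS](subrK 1 l) gmoment1_rec// subrK.
have := gmoment1_gt0 l1'; move: (gmoment 0 (l - 1) 1) => c c0.
have -> : 4 * ((l + 2^-1) / (l + 1) * ((l - 1 + 2^-1) / l * c) / 1 -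
   2 * ((l - 1 + 2^-1) / l * c) + 1 * c) / ((l - 1 + 2^-1) / l * c) =
   2 / (l - 2^-1) - 2 / (l + 1).
  field; rewrite !gt_eqF//; lra.
rewrite gerBl divr_ge0//; lra.
Qed.

(** The right-hand side is what the classical value [pi 2 ^ (- 2 l) Gamma (2 l + 1) / Gamma (l + 1)
    ^ 2] of the moment predicts. *)
Lemma log_deriv2_gmoment1 : log_deriv2 [set l | - 2^-1 < l] (fun l => gmoment 0 l 1)
  (fun l => 4 * etrigamma (2 * l + 1) - 2 * etrigamma (l + 1)).
Proof.
apply: log_deriv2_eq log_deriv2_gv => // l /= l1.
(* The difference of the two sides is 1-periodic and tends to 0 at infinity. *)
pose E (l : R) := gv l - (4 * etrigamma (2 * l + 1) - 2 * etrigamma (l + 1)).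
have Erec y : - 2^-1 < y -> E y = E (y + 1).
  move=> y1; rewrite /E (gv_rec y1).
  have y20 : 0 < 2 * y + 1 by lra.
  have y21 : 0 < 2 * y + 1 + 1 by lra.
  have y10 : 0 < y + 1 by lra.
  rewrite (etrigamma_rec y20) (etrigamma_rec y21) (etrigamma_rec y10).
  have -> : 2 * (y + 1) + 1 = 2 * y + 1 + 1 + 1 by ring.
  move: (gv (y + 1)) (etrigamma (2 * y + 1 + 1 + 1)) (etrigamma (y + 1 + 1)) => u v w.
  by field; rewrite !gt_eqF//; lra.
have En n : E l = E (l + n%:R).
  elim: n => [|n ->]; first by rewrite addr0.
  rewrite -[n.+1]addn1 natrD addrA; apply: Erec.
  by have : 0 <= n%:R :> R by []; lra.
(* In units of [1 / (y - 1 / 2)] the positive terms of [E y] are at most [2 + 8] and the negative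
   one at most [16] in absolute value, so [18] suffices. *)
have Ele y : 2^-1 < y -> `|E y| <= 18 / (y - 2^-1).
  move=> y1.
  have y0 : 0 < y - 2^-1 by lra.
  have yl : - 2^-1 < y by lra.
  have y2 : 0 < 2 * y + 1 by lra.
  have y3 : 0 < y + 1 by lra.
  have y4 : 1 < 2 * y + 1 by lra.
  have y5 : 1 < y + 1 by lra.
  have i0 : 0 < (y - 2^-1)^-1 by rewrite invr_gt0.
  have i1 : (y + 1 - 1)^-1 <= (y - 2^-1)^-1 by rewrite lef_pV2 ?posrE; lra.
  have i2 : (2 * y + 1 - 1)^-1 <= (y - 2^-1)^-1 by rewrite lef_pV2 ?posrE; lra.
  have h1 := gv_le y1; have h2 := gv_ge0 yl.
  have h3 := etrigamma_le y4; have h4 := etrigamma_ge0 y2.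
  have h5 := etrigamma_le y5; have h6 := etrigamma_ge0 y3.
  move: h1 h2 h3 h4 h5 h6 i0 i1 i2; rewrite /E ler_norml.
  move: (gv y) (etrigamma (2 * y + 1)) (etrigamma (y + 1)) => g t1 t2.
  by move: ((y - 2^-1)^-1) ((y + 1 - 1)^-1) ((2 * y + 1 - 1)^-1) => *; lra.
have : E l = 0.
  apply/eqP; rewrite -normr_le0; apply: (le0_of_inv_decay (C := 18) (b := l - 2^-1)) => // n.
  by rewrite (En n) addrAC => ln; apply: Ele; rewrite -subr_gt0.
by rewrite /E => /eqP; rewrite subr_eq0 => /eqP.
Qed.

End GegenbauerMoments.

(** * Monic Gegenbauer polynomials *)

Lemma natrS2 (R : pzSemiRingType) n : n.+2%:R = n%:R + 2 :> R.
Proof. by rewrite -natrD addn2. Qed.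

Lemma natrS3 (R : pzSemiRingType) n : n.+3%:R = n%:R + 3 :> R.
Proof. by rewrite -natrD addn3. Qed.

Section MonicGegenbauer.
Variable R : realType.
Implicit Types (l x : R) (p q : {poly R}).

(* At [n = 1] the factor [2 l / l] of the general formula is simplified, so that
   [l = 0] is allowed. *)
Definition gbeta l n : R :=
  if n == 1%N then (2 * (1 + l))^-1
  else n%:R * (n%:R + 2 * l - 1) / (4 * (n%:R + l) * (n%:R + l - 1)).

(** Defined by the three-term recurrence, so that differentiability in [l] is inherited from the
    rational coefficients [gbeta]. *)
Fixpoint gpoly l n : {poly R} :=
  if n is n1.+1 then
    (if n1 is n2.+1 then 'X * gpoly l n1 - gbeta l n1 *: gpoly l n2 else 'X)
  else 1.

Lemma gbeta0 l : gbeta l 0 = 0.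
Proof. by rewrite /gbeta/= !mul0r. Qed.

Lemma gpolyS l n : gpoly l n.+1 = 'X * gpoly l n - gbeta l n *: gpoly l n.-1.
Proof. by case: n => [|n] //; rewrite gbeta0 scale0r subr0 /= mulr1. Qed.

Lemma size_gpoly l n : size (gpoly l n) = n.+1 /\ gpoly l n \is monic.
Proof.
elim/ltn_ind: n => -[_|[_|n IH]] /=; first by rewrite size_poly1 monic1.
  by rewrite size_polyX monicX.
have [s1 m1] := IH n.+1 (leqnn _); have [s0 _] := IH n (leqnSn _).
have sX : size ('X * gpoly l n.+1) = n.+3.
  by rewrite mulrC size_mulX ?monic_neq0// s1.
have lt : (size (- (gbeta l n.+1 *: gpoly l n)) < size ('X * gpoly l n.+1)%R)%N.
  by rewrite size_polyN sX (leq_ltn_trans (size_scale_leq _ _))// s0.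
split; first by rewrite size_polyDl.
by rewrite monicE lead_coefDl// -monicE monicMr ?monicX.
Qed.

Variable l : R.
Hypothesis hl : - 2^-1 < l.

Lemma gbeta_gt0 n : 0 < gbeta l n.+1.
Proof.
have l1 := hl.
rewrite /gbeta; case: n => [|n]; first by rewrite eqxx /= invr_gt0; lra.
have n0 : 0 <= n%:R :> R by [].
rewrite eqSS /= natrS2 divr_gt0//; last by rewrite !mulr_gt0//; lra.
by rewrite mulr_gt0//; lra.
Qed.

(** [gsigma] and [grho] are the coefficients of [P_(n-1)'] in [x P_n'] and in [P_(n+1)']. At [n = 1]
    their denominators contain the factor [l], but there they multiply the derivative of the
    constant [P_0]. *)
Definition gsigma n : R := n%:R / (2 * (n%:R + l - 1)).
Definition grho n : R := n%:R * (n%:R + 1) / (4 * (n%:R + l) * (n%:R + l - 1)).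

Lemma gsigma_sub_gbeta n : gsigma n.+2 - gbeta l n.+2 = grho n.+2.
Proof.
have l1 := hl.
have n0 : 0 <= n%:R :> R by [].
rewrite /gsigma /gbeta /grho/= natrS2; field.
by rewrite !gt_eqF//; lra.
Qed.

Variable x : R.
Let P n := (gpoly l n).[x].
Let D n := (gpoly l n)^`().[x].

Let PS n : P n.+1 = x * P n - gbeta l n * P n.-1.
Proof. by rewrite /P gpolyS hornerD hornerN hornerZ hornerM hornerX. Qed.

Let DS n : D n.+1 = P n + x * D n - gbeta l n * D n.-1.
Proof.
by rewrite /D gpolyS derivB derivZ derivM derivX mul1r !hornerD hornerN hornerZ
  hornerM hornerX.
Qed.

Let P0 : P 0 = 1. Proof. by rewrite /P hornerC. Qed.
Let P1 : P 1 = x. Proof. by rewrite /P hornerX. Qed.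
Let D0 : D 0 = 0. Proof. by rewrite /D derivC hornerC. Qed.
Let D1 : D 1 = 1. Proof. by rewrite /D derivX hornerC. Qed.

(** The relation at one index and the recurrence give [P_(n+1)' = (n + 1) P_n + grho n P_(n-1)'];
    multiplying this by [x] and applying the relation to [P_(n-1)'] gives it at the next index.
    Hence the induction carries two consecutive instances. *)
Lemma mulX_deriv_gpoly n : x * D n = n%:R * P n + gsigma n * D n.-1.
Proof.
have l1 := hl.
suff [] : x * D n = n%:R * P n + gsigma n * D n.-1 /\
  x * D n.+1 = n.+1%:R * P n.+1 + gsigma n.+1 * D n by [].
elim/ltn_ind: n => -[_|[_|n IH]].
- by rewrite D0 D1 P1 /gsigma/= !mul0r !mulr0 !addr0 mulr1 mul1r.
- rewrite D1 DS /= D1 P1 D0 PS /= P1 P0 /gsigma /gbeta/=.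
  split; first by rewrite mulr0 addr0 mulr1 mul1r.
  by field; rewrite !gt_eqF//; lra.
have [Bn Bn1] := IH n.+1 (leqnn _); have [_ B] := IH n (leqnSn _).
split=> //.
have n0 : 0 <= n%:R :> R by [].
have A2 : D n.+3 = n.+3%:R * P n.+2 + grho n.+2 * D n.+1.
  rewrite DS Bn1 /= -gsigma_sub_gbeta -[n.+3%:R]natr1; ring.
have e1 : x * P n.+2 = P n.+3 + gbeta l n.+2 * P n.+1.
  by rewrite [P n.+3]PS; ring.
have Bp : x * D n.+1 = n.+1%:R * P n.+1 + gsigma n.+1 * D n by [].
rewrite A2 mulrDr mulrCA e1 mulrCA Bp.
(* The lowest case is separate: [gsigma 1] has the denominator [2 l], possibly zero, and must
   disappear through [D 0 = 0] before [field] applies. *)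
case: n IH Bn Bn1 B n0 A2 e1 Bp => [|n] IH Bn Bn1 B n0 A2 e1 Bp.
  rewrite /= D0 !mulr0 [D 2]DS /= D1 P1 D0 /gbeta /gsigma /grho /=.
  by field; rewrite !gt_eqF//; lra.
have A1 : D n.+3 = n.+3%:R * P n.+2 + grho n.+2 * D n.+1.
  by rewrite DS Bn /= -gsigma_sub_gbeta -[n.+3%:R]natr1; ring.
have {}n0 : 0 <= n%:R :> R by [].
rewrite A1 /gbeta /gsigma /grho /=; clear -l1 n0.
have e4 : n.+4%:R = n%:R + 4 :> R by rewrite -natrD addn4.
rewrite e4 (natrS3 R n) (natrS2 R n); move: (n%:R : R) n0 => m m0.
move: (P n.+4) (P n.+2) (D n.+1) => p q d.
by field; rewrite !gt_eqF//; lra.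
Qed.

Lemma deriv_gpolyS n : D n.+1 = n.+1%:R * P n + grho n * D n.-1.
Proof.
have l1 := hl.
rewrite DS mulX_deriv_gpoly -[n.+1%:R]natr1.
case: n => [|[|n]]; first by rewrite /= D0; ring.
  by rewrite /= D0; ring.
by rewrite -gsigma_sub_gbeta; ring.
Qed.

(** Write [(1 - x ^ 2) P_n'] as [P_n' - x (x P_n')] and apply [mulX_deriv_gpoly] twice.
    Differentiating the result once more yields the eigenvalue equation. *)
Lemma structure_gpoly n : (1 - x ^+ 2) * D n =
  - n%:R * P n.+1 + (n%:R + 2 * l) * gbeta l n * P n.-1.
Proof.
have l1 := hl.
case: n => [|[|n]].
- by rewrite D0 gbeta0 mulr0 oppr0 mul0r mulr0 mul0r addr0.
- rewrite D1 PS /= P1 P0 /gbeta/=; field.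
  by rewrite gt_eqF//; lra.
have n0 : 0 <= n%:R :> R by [].
have -> : (1 - x ^+ 2) * D n.+2 = D n.+2 - x * (x * D n.+2) by ring.
rewrite [x * D n.+2]mulX_deriv_gpoly mulrDr [x * (_ * D _)]mulrCA [x * D n.+1]mulX_deriv_gpoly.
have -> : P n.+3 = x * P n.+2 - gbeta l n.+2 * P n.+1 by exact: PS.
rewrite deriv_gpolyS.
case: n n0 => [|n] n0.
  rewrite /= D0 !mulr0 /gbeta /gsigma /grho/=; field.
  by rewrite !gt_eqF//; lra.
have {}n0 : 0 <= n%:R :> R by [].
rewrite /gbeta /gsigma /grho /=.
rewrite (natrS3 R n) (natrS2 R n); clear -l1 n0.
move: (P n.+3) (P n.+2) (P n.+1) (P n) (D n) (D n.+1) (n%:R : R) n0 => p3 p2 p1 p0 d d1 m m0.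
by field; rewrite !gt_eqF//; lra.
Qed.

End MonicGegenbauer.

Lemma poly_ext (R : realType) (p q : {poly R}) : (forall x, p.[x] = q.[x]) -> p = q.
Proof.
move=> pq; apply/eqP; rewrite -subr_eq0; apply: contraT => ne.
pose rs : seq R := [seq i%:R | i <- iota 0 (size (p - q))].
have h1 : all (root (p - q)) rs.
  by apply/allP => y _; rewrite rootE hornerD hornerN pq subrr.
have h2 : uniq rs by rewrite map_inj_uniq ?iota_uniq// => i j /eqP; rewrite eqr_nat => /eqP.
by have := max_poly_roots ne h1 h2; rewrite size_map size_iota ltnn.
Qed.

(** * The eigenvalue equation, orthogonality, norms and Parseval's identity *)

Section Orthogonality.
Variable R : realType.
Implicit Types (l x : R) (p q : {poly R}).

Definition gode l p := (1 - 'X^2) * p^`()^`() - (2 * l + 1) *: ('X * p^`()).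

Lemma deriv_structure_gpoly l n : - 2^-1 < l ->
  (1 - 'X^2) * (gpoly l n)^`() =
  - n%:R *: gpoly l n.+1 + ((n%:R + 2 * l) * gbeta l n) *: gpoly l n.-1.
Proof.
move=> l1; apply: poly_ext => x.
rewrite hornerM !hornerD hornerN hornerXn hornerC !hornerZ.
by rewrite structure_gpoly.
Qed.

(** Differentiating the structure relation leaves only first derivatives on the right; the
    contiguity relations reduce them to [P_n] and [P_(n-1)'], and the coefficient of the latter
    cancels. *)
Lemma gode_gpoly l n : - 2^-1 < l ->
  gode l (gpoly l n) = - (n%:R * (n%:R + 2 * l)) *: gpoly l n.
Proof.
move=> l1; apply: poly_ext => x.
have H : ((1 - 'X^2) * (gpoly l n)^`())^`().[x] = (- n%:R *: gpoly l n.+1 +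
    ((n%:R + 2 * l) * gbeta l n) *: gpoly l n.-1)^`().[x].
  by rewrite deriv_structure_gpoly.
move: H; rewrite derivM derivB derivC derivXn derivD !derivZ.
rewrite !(hornerD, hornerN, hornerM, hornerMn, hornerZ, hornerXn, hornerC, hornerX).
rewrite deriv_gpolyS// mulX_deriv_gpoly//.
move=> H.
have -> : (1 - x * x) * ((gpoly l n)^`()^`()).[x] =
  - n%:R * (n.+1%:R * (gpoly l n).[x] + grho l n * (gpoly l n.-1)^`().[x]) +
  (n%:R + 2 * l) * gbeta l n * (gpoly l n.-1)^`().[x] +
  2 * (n%:R * (gpoly l n).[x] + gsigma l n * (gpoly l n.-1)^`().[x]).
  by rewrite -H -mulX_deriv_gpoly// expr1; ring.
case: n H => [|[|n]] _.
- by rewrite gbeta0 /= derivC horner0; ring.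
- by rewrite /= derivC horner0; ring.
rewrite -gsigma_sub_gbeta// -[n.+3%:R]natr1 /gbeta /gsigma /= natrS2.
have n0 : 0 <= n%:R :> R by [].
move: (n%:R : R) n0 => m m0; move: ((gpoly l n.+2).[x]) ((gpoly l n.+1)^`().[x]) => u v.
by field; rewrite !gt_eqF//; lra.
Qed.

Section Moment.
Variable l : R.
Hypothesis hl : - 2^-1 < l.
Local Notation E := (gmoment 0 l).

Lemma gmoment0 k : gmoment k l 0 = 0.
Proof. by rewrite -[X in gmoment _ _ X](scale0r (0 : {poly R})) gmomentZ// mul0r. Qed.

Lemma gmomentN k p : gmoment k l (- p) = - gmoment k l p.
Proof. by rewrite -scaleN1r gmomentZ// mulN1r. Qed.

Lemma gmomentB k p q : gmoment k l (p - q) = gmoment k l p - gmoment k l q.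
Proof. by rewrite gmomentD// gmomentN. Qed.

(** By [gmoment_ibp] at [p' q], both sides equal minus the moment of [(1 - X ^ 2) p' q']. *)
Lemma gode_sym p q : E (gode l p * q) = E (p * gode l q).
Proof.
have key r s : E (gode l r * s) = - E ((1 - 'X^2) * (r^`() * s^`())).
  apply/eqP; rewrite -subr_eq0 opprK -gmomentD//; apply/eqP.
  rewrite -[RHS](gmoment_ibp (r^`() * s) hl); congr gmoment.
  rewrite /gode derivM -!mul_polyC; ring.
by rewrite key [p * _]mulrC key; congr (- E _); ring.
Qed.

Definition gnorm n := E (gpoly l n ^+ 2).

(** Eigenvectors of a symmetric operator: the eigenvalues differ by the factor
    [(n - k) (n + k + 2 l)], nonzero since the larger index is at least 1 and [2 l > -1]. *)
Lemma gpoly_orth n k : n != k -> E (gpoly l n * gpoly l k) = 0.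
Proof.
have l1 := hl.
wlog : n k / (k < n)%N => [H nk|kn _].
  have [kn|nk'|e] := ltngtP k n; first exact: H.
    by rewrite mulrC; apply: H => //; rewrite eq_sym.
  by rewrite e eqxx in nk.
have := gode_sym (gpoly l n) (gpoly l k).
rewrite !gode_gpoly// -scalerAl -scalerAr !gmomentZ// => /eqP.
rewrite -subr_eq0 -mulrBl mulf_eq0 => /orP[|/eqP//].
have -> : - (n%:R * (n%:R + 2 * l)) - - (k%:R * (k%:R + 2 * l)) =
  - ((n%:R - k%:R) * (n%:R + k%:R + 2 * l)) by ring.
rewrite oppr_eq0 mulf_eq0 subr_eq0 eqr_nat gtn_eqF//= => /eqP e.
have : 1 <= n%:R :> R by rewrite ler1n (leq_trans _ kn).
have : 0 <= k%:R :> R by [].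
lra.
Qed.

(** Multiplication by ['X] is symmetric: expand [X P_n] in one factor, move [X] to the other and
    expand [X P_n] again by the recurrence. *)
Lemma gnormS n : gnorm n.+1 = gbeta l n.+1 * gnorm n.
Proof.
rewrite /gnorm expr2 {1}gpolyS mulrBl gmomentB -scalerAl gmomentZ//.
rewrite [E (gpoly l n.-1 * _)]gpoly_orth ?mulr0 ?subr0; last by case: n => // n; rewrite neq_ltn ltnS leqW.
have -> : 'X * gpoly l n * gpoly l n.+1 = gpoly l n * gpoly l n.+2 + gbeta l n.+1 *: (gpoly l n * gpoly l n).
  rewrite [gpoly l n.+2]gpolyS /= -!mul_polyC; ring.
rewrite gmomentD// gpoly_orth ?add0r ?gmomentZ ?expr2//.
by rewrite neq_ltn ltnS leqW.
Qed.

Lemma gnorm_gt0 n : 0 < gnorm n.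
Proof.
elim: n => [|n IH]; last by rewrite gnormS mulr_gt0// gbeta_gt0.
by rewrite /gnorm expr1n gmoment1_gt0.
Qed.

(** Induction along a family with exactly one polynomial in each degree; it serves both [gpoly l]
    and an arbitrary orthonormal family. *)
Lemma size_basis_ind (q : nat -> {poly R}) (K : {poly R} -> Prop) n :
  (forall k, size (q k) = k.+1) -> K 0 ->
  (forall (a : R) k p, (k < n)%N -> (size p <= k)%N -> K p -> K (a *: q k + p)) ->
  forall p, (size p <= n)%N -> K p.
Proof.
move=> sq K0 KD.
suff H m : (m <= n)%N -> forall p, (size p <= m)%N -> K p by exact: H.
elim: m => [|m IH] mn p; first by rewrite leqn0 size_poly_eq0 => /eqP ->.
move=> sp; pose a := p`_m / lead_coef (q m).
have lq : lead_coef (q m) != 0 by rewrite lead_coef_eq0 -size_poly_eq0 sq.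
have sp' : (size (p - a *: q m)%R <= m)%N.
  apply/leq_sizeP => j; rewrite leq_eqVlt => /orP[/eqP <-|mj].
    rewrite coefB coefZ /a (_ : (q m)`_m = lead_coef (q m)); last by rewrite lead_coefE sq.
    by rewrite divfK ?subrr.
  by rewrite coefB coefZ !nth_default ?sq ?mulr0 ?subrr// (leq_trans sp).
rewrite -[p](subrKC (a *: q m)); apply: KD => //.
by apply: IH sp'; exact: ltnW.
Qed.

Lemma gpoly_orth_lt n p : (size p <= n)%N -> E (gpoly l n * p) = 0.
Proof.
apply: (size_basis_ind (q := gpoly l) (K := fun p => E (gpoly l n * p) = 0)).
- by move=> k; have [] := size_gpoly l k.
- by rewrite mulr0 gmoment0.
move=> a k q kn _ H; rewrite mulrDr -scalerAr gmomentD// gmomentZ// H addr0.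
by rewrite gpoly_orth ?mulr0// gtn_eqF.
Qed.

(** Parseval's identity for the orthogonal basis [gpoly l k], [k < n], obtained by splitting off the
    leading term. *)
Lemma gmoment_sqr_expand n p : (size p <= n)%N ->
  E (p ^+ 2) = \sum_(k < n) E (p * gpoly l k) ^+ 2 / gnorm k.
Proof.
elim: n p => [|n IH] p.
  by rewrite leqn0 size_poly_eq0 => /eqP ->; rewrite big_ord0 expr0n gmoment0.
move=> sp; have [sq mq] := size_gpoly l n.
pose a := p`_n; pose r := p - a *: gpoly l n.
have sr : (size r <= n)%N.
  apply/leq_sizeP => j; rewrite leq_eqVlt => /orP[/eqP <-|nj].
    rewrite coefB coefZ; have := monicP mq; rewrite lead_coefE sq/= => ->.
    by rewrite mulr1 subrr.
  by rewrite coefB coefZ !nth_default ?sq ?mulr0 ?subrr// (leq_trans sp).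
have pE : p = r + a *: gpoly l n by rewrite subrK.
have rn : E (r * gpoly l n) = 0 by rewrite mulrC gpoly_orth_lt.
have pn : E (p * gpoly l n) = a * gnorm n.
  by rewrite {1}pE mulrDl -scalerAl gmomentD// gmomentZ// rn add0r /gnorm expr2.
have pk (k : 'I_n) : E (p * gpoly l k) = E (r * gpoly l k).
  rewrite {1}pE mulrDl -scalerAl gmomentD// gmomentZ// gpoly_orth ?mulr0 ?addr0//.
  by rewrite gtn_eqF.
rewrite big_ord_recr /= pn; under eq_bigr do rewrite pk.
rewrite -IH// {1}pE.
have -> : (r + a *: gpoly l n) ^+ 2 = r ^+ 2 + (2 * a) *: (r * gpoly l n) + a ^+ 2 *: gpoly l n ^+ 2.
  rewrite -!mul_polyC; ring.
rewrite !gmomentD// !gmomentZ// rn mulr0 addr0 -/(gnorm n).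
have g0 := gnorm_gt0 n.
by congr (_ + _); field; rewrite gt_eqF.
Qed.

End Moment.
End Orthogonality.

(** * Dependence on the parameter *)

Section PolyDerivative.
Variable R : realType.
Implicit Types (l x : R) (p q : R -> {poly R}) (dp dq : {poly R}).

(** Coefficientwise derivative of a family of polynomials. The degree bound, uniform in the
    parameter, reduces evaluation and moments to finite sums over fixed monomials. *)
Definition is_pderive l p dp :=
  (exists N, forall y, (size (p y) <= N)%N) /\
  forall i, is_derive l 1 (fun y => (p y)`_i) dp`_i.

Lemma is_pderive_cst l dp : is_pderive l (fun=> dp) 0.
Proof.
split; first by exists (size dp).
by move=> i; rewrite coef0; exact: is_derive1_cst.
Qed.

Lemma is_pderiveD l p q dp dq : is_pderive l p dp -> is_pderive l q dq ->
  is_pderive l (fun y => p y + q y) (dp + dq).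
Proof.
move=> [[N pN] dp'] [[M qM] dq']; split.
  exists (maxn N M) => y; apply: leq_trans (size_polyD _ _) _.
  by rewrite geq_max !leq_max pN qM orbT.
move=> i; rewrite coefD; under eq_fun do rewrite coefD.
exact: is_derive1D.
Qed.

Lemma is_pderiveM l p q dp dq : is_pderive l p dp -> is_pderive l q dq ->
  is_pderive l (fun y => p y * q y) (dp * q l + p l * dq).
Proof.
move=> [[N pN] dp'] [[M qM] dq']; split.
  exists (N + M)%N => y; apply: leq_trans (size_polyMleq _ _) _.
  by rewrite (leq_trans (leq_pred _))// leq_add.
move=> i; rewrite coefD !coefM -big_split /=.
under eq_fun do rewrite coefM.
by apply: is_derive1_sum => j; exact: is_derive1M.
Qed.

Lemma is_pderiveC l (f : R -> R) (a : R) : is_derive l 1 f a ->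
  is_pderive l (fun y => (f y)%:P) a%:P.
Proof.
move=> df; split; first by exists 1%N => y; rewrite size_polyC leq_b1.
move=> i; rewrite coefC; under eq_fun do rewrite coefC.
by case: ifP => // _; exact: is_derive1_cst.
Qed.

Lemma is_pderiveZ l (f : R -> R) (a : R) p dp : is_derive l 1 f a ->
  is_pderive l p dp -> is_pderive l (fun y => f y *: p y) (a *: p l + f l *: dp).
Proof.
move=> df dp'; have := is_pderiveM (is_pderiveC df) dp'; rewrite !mul_polyC.
by rewrite (_ : (fun y => (f y)%:P * p y) = (fun y => f y *: p y))//;
  apply/funext => y; rewrite mul_polyC.
Qed.

Lemma is_pderiveN l p dp : is_pderive l p dp -> is_pderive l (fun y => - p y) (- dp).
Proof.
move=> [[N pN] dp']; split; first by exists N => y; rewrite size_polyN.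
by move=> i; rewrite coefN; under eq_fun do rewrite coefN; exact: is_derive1N.
Qed.

Lemma is_pderiveB l p q dp dq : is_pderive l p dp -> is_pderive l q dq ->
  is_pderive l (fun y => p y - q y) (dp - dq).
Proof. by move=> dp' dq'; apply: is_pderiveD => //; exact: is_pderiveN. Qed.

Lemma is_pderive_deriv l p dp : is_pderive l p dp ->
  is_pderive l (fun y => (p y)^`()) dp^`().
Proof.
move=> [[N pN] dp']; split.
  by exists N => y; rewrite (leq_trans (size_poly _ _))// (leq_trans (leq_pred _)).
move=> i; rewrite coef_deriv; under eq_fun do rewrite coef_deriv -mulr_natl.
apply: (is_deriveE (is_derive1M (is_derive1_cst _ l) (dp' i.+1))).
by rewrite mul0r add0r mulr_natl.
Qed.

Lemma is_pderive_unique A l p q dp dq : open A -> A l ->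
  (forall y, A y -> p y = q y) -> is_pderive l p dp -> is_pderive l q dq -> dp = dq.
Proof.
move=> oA Al pq [_ dp'] [_ dq']; apply/polyP => i.
apply: is_derive1_unique (dq' i); apply: (is_derive1_eq_on oA Al _ (dp' i)) => y Ay.
by rewrite pq.
Qed.

Let size_pderive l p dp N : (forall y, (size (p y) <= N)%N) ->
  (forall i, is_derive l 1 (fun y => (p y)`_i) dp`_i) -> (size dp <= N)%N.
Proof.
move=> pN dp'; apply/leq_sizeP => i Ni; apply: is_derive1_unique (dp' i) _.
rewrite (_ : (fun y => (p y)`_i) = fun=> 0); first exact: is_derive1_cst.
by apply/funext => y; rewrite nth_default// (leq_trans (pN y)).
Qed.

Lemma is_pderive_horner l p dp x : is_pderive l p dp ->
  is_derive l 1 (fun y => (p y).[x]) dp.[x].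
Proof.
move=> [[N pN] dp']; have dN := size_pderive pN dp'.
rewrite (horner_coef_wide _ dN).
under eq_fun do rewrite (horner_coef_wide _ (pN _)).
apply: is_derive1_sum => i.
apply: (is_deriveE (is_derive1M (dp' i) (is_derive1_cst _ l))).
by rewrite mulr0 addr0.
Qed.

Lemma gmoment_sum k l n (f : 'I_n -> {poly R}) : - 2^-1 < l ->
  gmoment k l (\sum_(i < n) f i) = \sum_(i < n) gmoment k l (f i).
Proof.
move=> l1; elim: n f => [|n IH] f; first by rewrite !big_ord0 gmoment0.
by rewrite !big_ord_recr /= gmomentD// IH.
Qed.

(** Product rule: one term differentiates the weight, which inserts a logarithm, the other the
    polynomial. *)
Lemma is_derive_gmoment_poly k l p dp : - 2^-1 < l -> is_pderive l p dp ->
  is_derive l 1 (fun y => gmoment k y (p y)) (gmoment k.+1 l (p l) + gmoment k l dp).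
Proof.
move=> l1 [[N pN] dp']; have dN := size_pderive pN dp'.
have exp (j : nat) (y : R) (q : {poly R}) : - 2^-1 < y -> (size q <= N)%N ->
    gmoment j y q = \sum_(i < N) q`_i * gmoment j y 'X^i.
  move=> y1 qN; have {1}-> : q = \sum_(i < N) q`_i *: 'X^i.
    rewrite -poly_def; apply/polyP => i; rewrite coef_poly.
    by case: ltnP => // Ni; rewrite nth_default// (leq_trans qN).
  by rewrite gmoment_sum//; apply: eq_bigr => i _; rewrite gmomentZ.
have oA : open [set y : R | - 2^-1 < y] by exact: open_gt.
apply: (is_derive1_eq_on oA l1 (f := fun y => \sum_(i < N) (p y)`_i * gmoment k y 'X^i)).
  by move=> y y1; rewrite -exp.
rewrite (exp _ _ (p l))// (exp _ _ dp)// -big_split /=.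
apply: is_derive1_sum => i.
apply: (is_deriveE (is_derive1M (dp' i) (is_derive_gmoment k 'X^i l1))).
by rewrite addrC.
Qed.

End PolyDerivative.

(** * Derivatives of the monic polynomials and of their norms in the parameter *)

Section ParameterDerivative.
Variable R : realType.
Implicit Types (l x : R) (p q : {poly R}).

Definition dgbeta l n : R := 'D_1 (fun y : R => gbeta y n) l.

Lemma is_derive_gbeta l n : - 2^-1 < l -> is_derive l 1 (fun y : R => gbeta y n.+1) (dgbeta l n.+1).
Proof.
move=> l1; apply: derivableP.
have dl a : is_derive l 1 (fun y => a + y) 1.
  apply: (is_deriveE (is_derive1D (is_derive1_cst a l) (is_derive1_id l))).
  by rewrite add0r.
rewrite /gbeta; case: n => [|n] /=.
  have dn : 2 * (1 + l) != 0 by rewrite gt_eqF//; lra.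
  exact: (@ex_derive _ _ _ _ _ _ _ (is_derive1V (f := fun y => 2 * (1 + y)) dn
    (is_derive1M (is_derive1_cst 2 l) (dl 1)))).
have n0 : 0 <= n%:R :> R by [].
have dn : 4 * (n.+2%:R + l) * (n.+2%:R + l - 1) != 0.
  by rewrite natrS2 gt_eqF// !mulr_gt0//; lra.
have d1 := is_derive1B (is_derive1D (is_derive1_cst n.+2%:R l)
  (is_derive1M (is_derive1_cst 2 l) (is_derive1_id l))) (is_derive1_cst 1 l).
have d2 := is_derive1M (is_derive1M (is_derive1_cst 4 l) (dl n.+2%:R))
  (is_derive1B (dl n.+2%:R) (is_derive1_cst 1 l)).
exact: (@ex_derive _ _ _ _ _ _ _ (is_derive1M (is_derive1M (is_derive1_cst n.+2%:R l) d1)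
  (is_derive1V (f := fun y => 4 * (n.+2%:R + y) * (n.+2%:R + y - 1)) dn d2))).
Qed.

Fixpoint dgpoly l n : {poly R} :=
  if n is n1.+1 then
    (if n1 is n2.+1 then
       'X * dgpoly l n1 - (dgbeta l n1 *: gpoly l n2 + gbeta l n1 *: dgpoly l n2)
     else 0)
  else 0.

Lemma is_pderive_gpoly l n : - 2^-1 < l -> is_pderive l (fun y : R => gpoly y n) (dgpoly l n).
Proof.
move=> l1; elim/ltn_ind: n => -[_|[_|n IH]]; try exact: is_pderive_cst.
have d1 := IH n.+1 (leqnn _); have d0 := IH n (leqnSn _).
have := is_pderiveB (is_pderiveM (is_pderive_cst l 'X) d1)
  (is_pderiveZ (is_derive_gbeta n l1) d0).
by rewrite mul0r add0r.
Qed.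

(** The coefficient of degree [n] is constantly 1, so its derivative vanishes. *)
Lemma size_dgpoly l n : - 2^-1 < l -> (size (dgpoly l n) <= n)%N.
Proof.
move=> l1; apply/leq_sizeP => i ni; have [_ /(_ i) H] := is_pderive_gpoly n l1.
apply: is_derive1_unique H _.
rewrite (_ : (fun y => _) = fun=> (i == n)%:R); first exact: is_derive1_cst.
apply/funext => y; have [s /monicP] := size_gpoly y n; rewrite lead_coefE s /= => m.
move: ni; rewrite leq_eqVlt => /orP[/eqP <-|ni]; first by rewrite m eqxx.
by rewrite nth_default ?s// gtn_eqF.
Qed.

Section Fixed.
Variable l : R.
Hypothesis hl : - 2^-1 < l.
Local Notation E := (gmoment 0 l).
Local Notation P := (gpoly l).
Local Notation dP := (dgpoly l).

Let oA : open [set y : R | - 2^-1 < y]. Proof. exact: open_gt. Qed.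

(** The inhomogeneous terms are the derivatives of the two explicit occurrences of [l], in the
    factor [2 l + 1] of [gode] and in the eigenvalue. *)
Lemma gode_dgpoly n : gode l (dP n) = 2 *: ('X * (P n)^`()) -
  ((2 * n%:R) *: P n + (n%:R * (n%:R + 2 * l)) *: dP n).
Proof.
have dg := is_pderive_gpoly n hl; have dg1 := is_pderive_deriv dg.
have dg2 := is_pderive_deriv dg1.
have d21 : is_derive l 1 (fun y => 2 * y + 1) 2 by exact: is_derive1_affine.
have dn : is_derive l 1 (fun y => n%:R * (n%:R + 2 * y)) (2 * n%:R).
  have := is_derive1_affine (n%:R * 2) (n%:R * n%:R) l.
  rewrite (_ : (fun y => _ * y + _) = (fun y => n%:R * (n%:R + 2 * y))).
    by move=> H; apply: (is_deriveE H); rewrite mulrC.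
  by apply/funext => y; ring.
have H := is_pderiveD (is_pderiveB (is_pderiveM (is_pderive_cst l (1 - 'X^2)) dg2)
  (is_pderiveZ d21 (is_pderiveM (is_pderive_cst l 'X) dg1))) (is_pderiveZ dn dg).
have Z0 (y : R) : - 2^-1 < y -> gode y (gpoly y n) + (n%:R * (n%:R + 2 * y)) *: gpoly y n = 0.
  by move=> y1; rewrite gode_gpoly// -scalerDl addNr scale0r.
have Z := is_pderive_unique (@oA) hl Z0 H (is_pderive_cst l 0).
apply/eqP; rewrite -subr_eq0; apply/eqP; rewrite -[RHS]Z /gode -!mul_polyC.
by rewrite !polyCM !polyCD !polyCM; ring.
Qed.

(* The differentiated eigenvalue equation [gode_dgpoly], paired with [P k]. *)
Lemma dgpoly_coef n k : (k < n)%N ->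
  (n%:R - k%:R) * (n%:R + k%:R + 2 * l) * E (dP n * P k) = 2 * E ('X * (P n)^`() * P k).
Proof.
move=> kn; have H := gode_sym hl (dP n) (P k); move: H.
rewrite gode_dgpoly gode_gpoly// mulrBl mulrDl -3!scalerAl -scalerAr.
rewrite gmomentB// gmomentD// !gmomentZ// gpoly_orth ?mulr0 ?add0r//; last by rewrite gtn_eqF.
by move: (E (dP n * P k)) (E ('X * _ * _)) => u v; lra.
Qed.

(* Derivative in [l] of the orthogonality of [P n] to smaller degrees. *)
Lemma gmoment1_gpoly_lt n q : (size q <= n)%N ->
  gmoment 1 l (P n * q) = - E (dP n * q).
Proof.
apply: (size_basis_ind (q := gpoly l) (K := fun q => gmoment 1 l (P n * q) = - E (dP n * q))).
- by move=> k; have [] := size_gpoly l k.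
- by rewrite !mulr0 !gmoment0// oppr0.
move=> a k p kn _ H; rewrite !mulrDr -!scalerAr !gmomentD// !gmomentZ// H.
rewrite opprD -mulrN; congr (_ + _); congr (_ * _).
have d := is_derive_gmoment_poly 0 hl
  (is_pderiveM (is_pderive_gpoly n hl) (is_pderive_gpoly k hl)).
have z : gmoment 1 l (P n * P k) + E (dP n * P k + P n * dP k) = 0.
  apply: is_derive1_unique d _.
  apply: (is_derive1_eq_on (@oA) hl _ (is_derive1_cst 0 l)) => y y1.
  by rewrite gpoly_orth// gtn_eqF.
move: z; rewrite gmomentD// [E (P n * dP k)]gpoly_orth_lt//.
  by rewrite addr0 => /eqP; rewrite addr_eq0 => /eqP.
by rewrite (leq_trans (size_dgpoly _ _))// ltnW.
Qed.

Lemma is_derive_gnorm n : is_derive l 1 (fun y : R => gnorm y n) (gmoment 1 l (P n ^+ 2)).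
Proof.
have d := is_derive_gmoment_poly 0 hl
  (is_pderiveM (is_pderive_gpoly n hl) (is_pderive_gpoly n hl)).
apply: (is_deriveE d); rewrite -expr2 [dP n * _]mulrC gmomentD// gpoly_orth_lt ?size_dgpoly//.
by rewrite !addr0.
Qed.

(** Each of the two cross terms is the first log-moment of [P n * dP n], which is minus the squared
    norm of [dP n] by [gmoment1_gpoly_lt]. *)
Lemma is_derive_gnorm2 n : is_derive l 1 (fun y => gmoment 1 y (gpoly y n ^+ 2))
  (gmoment 2 l (P n ^+ 2) - 2 * E (dP n ^+ 2)).
Proof.
have d := is_derive_gmoment_poly 1 hl
  (is_pderiveM (is_pderive_gpoly n hl) (is_pderive_gpoly n hl)).
apply: (is_deriveE d); rewrite -expr2 [dP n * _]mulrC gmomentD// gmoment1_gpoly_lt ?size_dgpoly//.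
by rewrite -expr2; ring.
Qed.

End Fixed.
End ParameterDerivative.

(** * The pairings of [x P_n'] with [P_k], and the logarithm of the norms *)

Section Connection.
Variable R : realType.
Implicit Types (l x : R) (p q : {poly R}).

(* The value [(k + l) * Gamma (k + 2 l)], extended by continuity to [k = l = 0]. *)
Definition gconst k l : R :=
  if k == 0%N then euler_integral (2 * l + 1) / 2
  else (k%:R + l) * euler_integral (k%:R + 2 * l).

(** The value of the squared pairing of [x P_n'] with [P_k], divided by both squared norms; odd
    differences vanish by parity. *)
Definition gconnect n k l : R := if odd (n - k) then 0 else
  4 * (n%:R + l) * n`!%:R / k`!%:R * gconst k l / euler_integral (n%:R + 2 * l).

Section Fixed.
Variable l : R.
Hypothesis hl : - 2^-1 < l.
Local Notation E := (gmoment 0 l).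
Local Notation P := (gpoly l).

Let dd m k := E ((P m)^`() * P k).
Let bb n k := E ('X * (P n)^`() * P k).

Let deriv_gpolySE n : (P n.+1)^`() = n.+1%:R *: P n + grho l n *: (P n.-1)^`().
Proof. by apply: poly_ext => x; rewrite hornerD !hornerZ deriv_gpolyS. Qed.

Let mulX_derivE n : 'X * (P n)^`() = n%:R *: P n + gsigma l n *: (P n.-1)^`().
Proof. by apply: poly_ext => x; rewrite hornerD !hornerZ hornerM hornerX mulX_deriv_gpoly. Qed.

Let size_deriv_gpoly n : (size (P n)^`() <= n)%N.
Proof. by have [s _] := size_gpoly l n; rewrite (leq_trans (size_poly _ _))// s. Qed.

Let dd0 m k : (m <= k)%N -> dd m k = 0.
Proof.
move=> mk; rewrite /dd mulrC gpoly_orth_lt//.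
exact: leq_trans (size_deriv_gpoly m) mk.
Qed.

Let ddS m k : dd m.+1 k = m.+1%:R * E (P m * P k) + grho l m * dd m.-1 k.
Proof. by rewrite /dd deriv_gpolySE mulrDl -2!scalerAl gmomentD// !gmomentZ. Qed.

Let ddSk k : dd k.+1 k = k.+1%:R * gnorm l k.
Proof. by rewrite ddS dd0 ?mulr0 ?addr0 ?leq_pred//. Qed.

Let dd_rec m k : (k < m)%N -> dd m.+1 k = grho l m * dd m.-1 k.
Proof. by move=> km; rewrite ddS gpoly_orth ?mulr0 ?add0r// gtn_eqF. Qed.

Let bbE n k : (k < n)%N -> bb n k = gsigma l n * dd n.-1 k.
Proof.
move=> kn; rewrite /bb mulX_derivE mulrDl -2!scalerAl gmomentD// !gmomentZ//.
by rewrite gpoly_orth ?mulr0 ?add0r// gtn_eqF.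
Qed.

(** The recursion lowers the index by two, and for an odd difference it ends at the pairing of
    [P_k'] with [P_k], which is zero. *)
Let bb_odd j k : bb (k + j.*2.+1) k = 0.
Proof.
have H i : dd (k + i.*2) k = 0.
  elim: i => [|i IH]; first by rewrite addn0 dd0.
  by rewrite doubleS !addnS dd_rec/= ?IH ?mulr0// ltnS leq_addr.
by rewrite bbE ?addnS/= ?H ?mulr0// ltnS leq_addr.
Qed.

Let eul_gt0 (y : R) : 0 < y -> 0 < euler_integral y.
Proof. exact: euler_integral_gt0. Qed.

(** Induction in steps of two from [n = k + 2]. Each step multiplies the left side by a squared
    ratio over two [gbeta] factors and the right side by the matching ratio of
    [(n + l) n! / Gamma (n + 2 l)]. *)
Let bb_even j k : bb (k + j.*2.+2) k ^+ 2 / (gnorm l (k + j.*2.+2) * gnorm l k) =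
  4 * ((k + j.*2.+2)%:R + l) * (k + j.*2.+2)`!%:R / k`!%:R * gconst k l /
  euler_integral ((k + j.*2.+2)%:R + 2 * l).
Proof.
have l1 := hl.
have hk := gnorm_gt0 hl k.
have k0 : 0 <= k%:R :> R by [].
have fk : 0 < k`!%:R :> R by rewrite ltr0n fact_gt0.
elim: j => [|j IH].
  rewrite double0 addn2 bbE// ddSk !gnormS// !factS !natrM.
  have -> : euler_integral (k.+2%:R + 2 * l) = (k.+1%:R + 2 * l) * euler_integral (k.+1%:R + 2 * l).
    rewrite -euler_integralS; last by rewrite -natr1; lra.
    by congr euler_integral; rewrite -[k.+2%:R]natr1; ring.
  (* At [k = 0] both [gbeta l 1] and [gconst 0 l] take their special branch, the one regular at
     [l = 0]. *)
  case: k hk k0 fk => [|k] hk k0 fk.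
    have e0 : 0 < euler_integral (1 + 2 * l) by apply: eul_gt0; lra.
    rewrite /gsigma /gbeta /gconst/= fact0 [2 * l + 1]addrC; field.
    by rewrite !gt_eqF//; lra.
  have {}k0 : 0 <= k%:R :> R by [].
  have -> : euler_integral (k.+2%:R + 2 * l) = (k.+1%:R + 2 * l) * euler_integral (k.+1%:R + 2 * l).
    rewrite -euler_integralS; last by rewrite -natr1; lra.
    by congr euler_integral; rewrite -[k.+2%:R]natr1; ring.
  have e0 : 0 < euler_integral (k.+1%:R + 2 * l) by apply: eul_gt0; rewrite -natr1; lra.
  rewrite /gsigma /gbeta /gconst/=.
  move: (euler_integral _) (gnorm l _) (_`!%:R) e0 hk fk => e h f e0 h0 f0.
  rewrite (natrS3 R k) (natrS2 R k) -(natr1 k).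
  move: (k%:R : R) k0 => m m0; field.
  by rewrite !gt_eqF//; lra.
set n := (k + j.*2.+2)%N in IH *.
have -> : (k + j.+1.*2.+2)%N = n.+2 by rewrite /n doubleS !addnS.
have kn : (k < n)%N by rewrite /n !addnS ltnS -addnS leq_addr.
have [m nE] : exists m, n = m.+2 by exists (k + j.*2)%N; rewrite /n !addnS.
have hn := gnorm_gt0 hl n.
have m0 : 0 <= m%:R :> R by [].
(* The ratio is [gsigma n.+2 * grho n / gsigma n]. *)
have bE : bb n.+2 k = (n.+2%:R * n.+1%:R / (4 * (n.+1%:R + l) * (n%:R + l))) * bb n k.
  rewrite !bbE ?leqW//= dd_rec// mulrA [RHS]mulrA; congr (_ * _).
  rewrite nE /gsigma /grho -[m.+4%:R]natr1 (natrS3 R m) (natrS2 R m).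
  by field; rewrite !gt_eqF//; lra.
have -> : bb n.+2 k ^+ 2 / (gnorm l n.+2 * gnorm l k) =
   (n.+2%:R * n.+1%:R / (4 * (n.+1%:R + l) * (n%:R + l))) ^+ 2 / (gbeta l n.+2 * gbeta l n.+1) *
   (bb n k ^+ 2 / (gnorm l n * gnorm l k)).
  rewrite bE !gnormS//; have b1 := gbeta_gt0 hl n; have b2 := gbeta_gt0 hl n.+1.
  have nm : n%:R = m%:R + 2 :> R by rewrite nE natrS2.
  have q2 : 0 < n%:R + l by rewrite nm; lra.
  have q1 : 0 < n.+1%:R + l by rewrite -natr1; lra.
  move: (gbeta l n.+1) (gbeta l n.+2) (gnorm l n) b1 b2 hn => ? ? ? *.
  move: (n.+1%:R : R) (n.+2%:R : R) (n%:R : R) q1 q2 => ? ? ? *.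
  by field; rewrite !gt_eqF.
rewrite IH !factS !natrM.
have -> : euler_integral (n.+2%:R + 2 * l) =
    (n.+1%:R + 2 * l) * ((n%:R + 2 * l) * euler_integral (n%:R + 2 * l)).
  rewrite -euler_integralS; last by rewrite nE (natrS2 R m); lra.
  have -> : n%:R + 2 * l + 1 = n.+1%:R + 2 * l by rewrite -[n.+1%:R]natr1; ring.
  rewrite -euler_integralS; last by rewrite -[n.+1%:R]natr1 nE (natrS2 R m); lra.
  by congr euler_integral; rewrite -[n.+2%:R]natr1; ring.
have e0 : 0 < euler_integral (n%:R + 2 * l) by apply: eul_gt0; rewrite nE (natrS2 R m); lra.
have nm : n%:R = m%:R + 2 :> R by rewrite nE natrS2.
have fn : 0 < n`!%:R :> R by rewrite ltr0n fact_gt0.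
rewrite /gbeta; have -> : (n.+2 == 1)%N = false by [].
have -> : (n.+1 == 1)%N = false by rewrite nE.
rewrite (natrS2 R n) -(natr1 n).
move: (gconst k l) (euler_integral _) (k`!%:R : R) (n`!%:R : R) e0 fk fn => g e f f' e0 f0 f0'.
move: (n%:R : R) nm => n' nm; field.
by rewrite !gt_eqF//; lra.
Qed.

Lemma connection_sqr n k : (k < n)%N ->
  E ('X * (P n)^`() * P k) ^+ 2 / (gnorm l n * gnorm l k) = gconnect n k l.
Proof.
move=> kn; rewrite /gconnect -/(bb n k).
have nE : n = (k + (n - k))%N by rewrite subnKC// ltnW.
have nk0 : (0 < n - k)%N by rewrite subn_gt0.
rewrite {1 2}nE; move: (n - k)%N nE nk0 => m; have := odd_double_half m.
case: ifP => om; rewrite ?add1n ?add0n => mE nE nk0.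
  by rewrite -mE bb_odd expr0n mul0r.
rewrite {}nE; case: (m./2) mE nk0 => [|j] <-// _.
by rewrite doubleS bb_even.
Qed.

End Fixed.

(* At [n = 0] the two rational terms cancel for [l != 0]; the case distinction
   keeps the formula continuous at [l = 0]. *)
Definition gnorm_log2 n l : R := 4 * etrigamma (n%:R + 2 * l + 1) - 2 * etrigamma (n%:R + l + 1) +
  (if n == 0%N then 0 else 4 / (n%:R + 2 * l) ^+ 2 - 1 / (n%:R + l) ^+ 2).

(** Induction through [gnormS]: the rational terms coming from [gbeta] are exactly those by which
    [etrigamma_rec] shifts the arguments. *)
Lemma log_deriv2_gnorm n : log_deriv2 [set l : R | - 2^-1 < l] (fun l => gnorm l n) (gnorm_log2 n).
Proof.
have oA : open [set y : R | - 2^-1 < y] by exact: open_gt.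
elim: n => [|n IH].
  apply: log_deriv2_eq (@log_deriv2_gmoment1 R) => // l l1.
    by rewrite /gnorm expr1n.
  by rewrite /gnorm_log2 /= addr0 !add0r.
have gl (a : R) : 0 <= a -> forall l, [set l : R | - 2^-1 < l] l -> 0 < 2 * l + (a + 1).
  by move=> a0 l /= l1; lra.
(* The step from 0 to 1 uses the special value of [gbeta l 1] and the special rational part of
   [gnorm_log2] at 0. *)
case: n IH => [|n] IH.
  have p2 l : [set l : R | - 2^-1 < l] l -> 0 < 2 * l + 2 by rewrite /=; lra.
  apply: log_deriv2_eq (log_deriv2M (@oA) (log_deriv2V (@oA) (log_deriv2_affine p2)) IH) => //.
    move=> l l1; rewrite gnormS// /gbeta eqxx.
    by have -> : 2 * (1 + l) = 2 * l + 2 by ring.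
  move=> l /= l1; rewrite /gnorm_log2/= !add0r.
  rewrite [etrigamma (2 * l + 1)]etrigamma_rec; last lra.
  rewrite [etrigamma (l + 1)]etrigamma_rec; last lra.
  rewrite ![1 + _ * _]addrC ![1 + l]addrC.
  by move: (etrigamma (2 * l + 1 + 1)) (etrigamma (l + 1 + 1)) => u v; field; rewrite !gt_eqF//; lra.
have n0 : 0 <= n%:R :> R by [].
have p1 l : [set l : R | - 2^-1 < l] l -> 0 < 2 * l + (n%:R + 1) by rewrite /=; lra.
have p2 l : [set l : R | - 2^-1 < l] l -> 0 < 1 * l + (n%:R + 2) by rewrite /=; lra.
have p3 l : [set l : R | - 2^-1 < l] l -> 0 < 1 * l + (n%:R + 1) by rewrite /=; lra.
have c0 : 0 < n.+2%:R / 4 :> R by rewrite divr_gt0// ltr0n.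
have H := log_deriv2M (@oA) (log_deriv2M (@oA) (log_deriv2M (@oA) (log_deriv2M (@oA)
  (log_deriv2_cst _ c0) (log_deriv2_affine p1)) (log_deriv2V (@oA) (log_deriv2_affine p2)))
  (log_deriv2V (@oA) (log_deriv2_affine p3))) IH.
apply: log_deriv2_eq H => // l /= l1.
  rewrite [RHS]gnormS//; congr (_ * _); rewrite /gbeta /= (natrS2 R n); field.
  by rewrite !gt_eqF//; lra.
rewrite /gnorm_log2/= (natrS2 R n) -(natr1 n).
rewrite [etrigamma (n%:R + 1 + 2 * l + 1)]etrigamma_rec; last lra.
rewrite [etrigamma (n%:R + 1 + l + 1)]etrigamma_rec; last lra.
have -> : n%:R + 1 + 2 * l + 1 + 1 = n%:R + 2 + 2 * l + 1 by ring.
have -> : n%:R + 1 + l + 1 + 1 = n%:R + 2 + l + 1 by ring.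
move: (etrigamma (n%:R + 2 + 2 * l + 1)) (etrigamma (n%:R + 2 + l + 1)) => u v.
by move: (n%:R : R) n0 => m m0; field; rewrite !gt_eqF//; lra.
Qed.

End Connection.

(** * The Fisher information *)

Section FisherIntegral.
Variable R : realType.
Local Notation mu := (@lebesgue_measure R).
Local Notation D := (`](-1)%R, 1%R[%classic : set R).
Implicit Types (l x : R) (p q : {poly R}).

(** The endpoints are a null set. On the open interval [1 - x ^ 2] is positive, so its logarithm is
    meaningful. *)
Lemma integral_closed_open (f g : R -> R) : mu.-integrable D (EFin \o g) ->
  (forall x, D x -> f x = g x) ->
  (\int[mu]_(x in `[(-1)%R, 1%R]) (f x)%:E = (\int[mu]_(x in D) g x)%:E)%E.
Proof.
move=> ig fg.
have mD : (R.-ocitv.-measurable).-sigma.-measurable D by exact: measurable_itv.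
have fgE : {in D, (EFin \o g) =1 (EFin \o f)} by move=> x /set_mem Dx /=; rewrite fg.
have ifD := eq_integrable mD _ _ fgE ig.
have m1 : measurable_fun D (EFin \o f) := measurable_int _ ifD.
rewrite (integral_itv_bndoo _ _ m1) /Rintegral (fineK (integrable_fin_num mD ig)).
by apply: eq_integral => x /set_mem Dx /=; rewrite fg.
Qed.

Lemma integral_gegenbauer_weight l p : - 2^-1 < l ->
  (\int[mu]_(x in `[(-1)%R, 1%R]) (p.[x] * gegenbauer_weight l x)%:E = (gmoment 0 l p)%:E)%E.
Proof.
move=> l1; apply: integral_closed_open; first exact: integrable_gmoment.
by move=> x _; rewrite /mellin_integrand expr0 mul1r mulrC.
Qed.

(** After subtracting the leading term, the remainder [q] of degree below [n] is orthogonal to all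
    smaller degrees. Were it nonzero of degree [m], pairing with [gpoly l m] would give its leading
    coefficient times a positive norm. The norm fixes the scalar up to sign, and positivity of the
    leading coefficient fixes the sign. *)
Lemma orthonormal_gegenbauerE l (c : nat -> {poly R}) n : - 2^-1 < l ->
  orthonormal_gegenbauer l c -> c n = (Num.sqrt (gnorm l n))^-1 *: gpoly l n.
Proof.
move=> l1 [sc lc oc].
have Ec i j : gmoment 0 l (c i * c j) = (i == j)%:R.
  apply: EFin_inj; rewrite -(oc i j) -integral_gegenbauer_weight//.
  by apply: eq_integral => x _; rewrite hornerM.
have clt q : (size q <= n)%N -> gmoment 0 l (c n * q) = 0.
  apply: (size_basis_ind (q := c) (K := fun q => gmoment 0 l (c n * q) = 0)) => //.
    by rewrite mulr0 gmoment0.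
  move=> a k r kn _ H; rewrite mulrDr -scalerAr gmomentD// gmomentZ// H addr0.
  by rewrite Ec gtn_eqF// mulr0.
have [sP mP] := size_gpoly l n.
pose a := lead_coef (c n); pose q := c n - a *: gpoly l n.
have sq : (size q <= n)%N.
  apply/leq_sizeP => j; rewrite leq_eqVlt => /orP[/eqP <-|nj].
    rewrite coefB coefZ; have := monicP mP; rewrite lead_coefE sP/= => ->.
    by rewrite mulr1 /a lead_coefE sc subrr.
  by rewrite coefB coefZ !nth_default ?sP ?sc ?mulr0 ?subrr.
have q0 : q = 0.
  apply/eqP; rewrite -size_poly_eq0; case sqE: (size q) sq => [//|m] mn.
  have [sPm mPm] := size_gpoly l m.
  have Eq : gmoment 0 l (q * gpoly l m) = 0.
    rewrite mulrBl -scalerAl gmomentB// gmomentZ// clt ?sPm//.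
    by rewrite gpoly_orth_lt ?sPm// mulr0 subr0.
  pose r := q - lead_coef q *: gpoly l m.
  have sr : (size r <= m)%N.
    apply/leq_sizeP => j; rewrite leq_eqVlt => /orP[/eqP <-|mj].
      rewrite coefB coefZ; have := monicP mPm; rewrite lead_coefE sPm/= => ->.
      by rewrite mulr1 lead_coefE sqE subrr.
    by rewrite coefB coefZ !nth_default ?sPm ?sqE ?mulr0 ?subrr.
  have := Eq; rewrite -[q](subrK (lead_coef q *: gpoly l m)) -/r mulrDl -scalerAl.
  rewrite gmomentD// gmomentZ// [r * _]mulrC gpoly_orth_lt// add0r -expr2 => /eqP.
  rewrite mulf_eq0 lead_coef_eq0 -/(gnorm l m) (gt_eqF (gnorm_gt0 l1 m)) orbF.
  by rewrite -size_poly_eq0 sqE.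
have cE : c n = a *: gpoly l n by rewrite -[LHS](subrK (a *: gpoly l n)) -/q q0 add0r.
have a0 : 0 < a by exact: lc.
have := Ec n n; rewrite eqxx cE -scalerAl -scalerAr !gmomentZ// -expr2 -/(gnorm l n) => h1'.
have h1 : a * (a * gnorm l n) = 1 := h1'.
have h0 := gnorm_gt0 l1 n.
congr (_ *: _).
have -> : gnorm l n = a^-1 ^+ 2.
  have an0 : a != 0 by rewrite gt_eqF.
  by apply: (mulfI an0); apply: (mulfI an0); rewrite h1; field.
by rewrite sqrtr_sqr ger0_norm ?invrK// invr_ge0 ltW.
Qed.

(** Intermediate form between the integral and the stated value, valid for all [- 2^-1 < l]
    including 0. *)
Definition fisher_closed n l : R := gnorm_log2 n l +
  \sum_(k < n) 8 * gconnect n k l / ((n%:R - k%:R) ^+ 2 * (n%:R + k%:R + 2 * l) ^+ 2).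

(** Parseval's identity with the coefficients from [dgpoly_coef]; the constant is
    [8 = 2 * 2 ^ 2]. *)
Lemma dgpoly_sqr l n : - 2^-1 < l ->
  2 * (gmoment 0 l (dgpoly l n ^+ 2) / gnorm l n) =
  \sum_(k < n) 8 * gconnect n k l / ((n%:R - k%:R) ^+ 2 * (n%:R + k%:R + 2 * l) ^+ 2).
Proof.
move=> l1; rewrite (gmoment_sqr_expand l1 (size_dgpoly n l1)) mulr_suml mulr_sumr.
apply: eq_bigr => k _; have kn := ltn_ord k.
rewrite -connection_sqr//; have := dgpoly_coef l1 kn.
have hn := gnorm_gt0 l1 n; have hk := gnorm_gt0 l1 k.
have nk : 0 < n%:R - k%:R :> R by rewrite subr_gt0 ltr_nat.
have nk2 : 0 < n%:R + k%:R + 2 * l.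
  have n1 : 1 <= n%:R :> R by rewrite ler1n (leq_trans _ kn).
  have k0 : 0 <= k%:R :> R by [].
  lra.
move: (gmoment 0 l (dgpoly l n * gpoly l k)) => u.
move: (gmoment 0 l ('X * (gpoly l n)^`() * gpoly l k)) => v.
move: nk nk2; move: (n%:R - k%:R) (n%:R + k%:R + 2 * l) => s t s0 t0 e.
have -> : v = s * t * u / 2 by rewrite e; field.
move: (gnorm l n) (gnorm l k) hn hk => h h' h0 h0'.
by field; rewrite !gt_eqF.
Qed.

Lemma is_derive_inv_sqrt (f : R -> R) (a x : R) : 0 < f x -> is_derive x 1 f a ->
  is_derive x 1 (fun y => (Num.sqrt (f y))^-1) (- (a / (2 * f x)) * (Num.sqrt (f x))^-1).
Proof.
move=> f0 df; have s0 : 0 < Num.sqrt (f x) by rewrite sqrtr_gt0.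
have sn0 : Num.sqrt (f x) != 0 by rewrite gt_eqF.
have ds := is_derive1_compose (is_derive1_sqrt f0) df.
apply: (is_deriveE (is_derive1V (f := fun y => Num.sqrt (f y)) sn0 ds)).
have e := sqr_sqrtr (ltW f0); clear -s0 e; move: (Num.sqrt (f x)) s0 e => s s0 e.
rewrite -e.
by field; rewrite gt_eqF.
Qed.

Lemma is_derive_sqrt_weight (l x : R) : D x ->
  is_derive l 1 (fun y => Num.sqrt (gegenbauer_weight y x))
    (ln (1 - x ^+ 2) / 2 * Num.sqrt (gegenbauer_weight l x)).
Proof.
move=> Dx; have px := one_sub_sqr_gt0 Dx.
have wE y : Num.sqrt (gegenbauer_weight y x) = (1 - x ^+ 2) `^ (2^-1 * y + - 4^-1).
  rewrite -powR12_sqrt ?powR_ge0// /gegenbauer_weight -powRrM; congr (_ `^ _).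
  by field.
under eq_fun do rewrite wE; rewrite wE.
have d := is_derive1_compose (g := fun y => 2^-1 * y + - 4^-1)
  (is_derive_powRr (2^-1 * l + - 4^-1) px) (is_derive1_affine 2^-1 (- 4^-1) l).
apply: (is_deriveE d); by rewrite mulrAC.
Qed.

Variable C : R -> nat -> {poly R}.
Hypothesis hC : forall l : R, - 2^-1 < l -> orthonormal_gegenbauer l (C l).

Lemma gegenbauer_fisherE n l : - 2^-1 < l ->
  gegenbauer_fisher C n l = (fisher_closed n l)%:E.
Proof.
move=> l1.
have oA : open [set y : R | - 2^-1 < y] by exact: open_gt.
pose P := gpoly l n; pose dP := dgpoly l n.
pose h := gnorm l n; pose h1 := gmoment 1 l (P ^+ 2).
pose S := gmoment 0 l (dP ^+ 2).
pose k := (Num.sqrt h)^-1; pose k1 := - (h1 / (2 * h)) * k.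
have h0 : 0 < h by exact: gnorm_gt0.
have kk : k ^+ 2 = h^-1 by rewrite /k exprVn sqr_sqrtr// ltW.
have dC x : is_derive l 1 (fun y => (C y n).[x]) (k1 * P.[x] + k * dP.[x]).
  have dk := is_derive_inv_sqrt (f := fun y => gnorm y n) h0 (is_derive_gnorm l1 n).
  have dp := is_pderive_horner x (is_pderive_gpoly n l1).
  apply: (is_derive1_eq_on (@oA) l1 _ (is_derive1M dk dp)) => y y1.
  by rewrite (orthonormal_gegenbauerE n y1 (hC y1)) hornerZ.
(* With [r] the derivative in [l] of the orthonormal polynomial and [L = ln (1 - x ^ 2)], the
   squared derivative is the weight times [(L / 2 * k * P + r) ^ 2]; [p2], [p1] and [r ^+ 2] are its
   coefficients by powers of [L]. *)
pose p2 := (k ^+ 2 / 4) *: P ^+ 2.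
pose r := k1 *: P + k *: dP.
pose p1 := k *: (P * r).
pose g x := mellin_integrand (fun x => 1 - x ^+ 2) (fun x => p2.[x]) 2 (l - 2^-1) x +
  mellin_integrand (fun x => 1 - x ^+ 2) (fun x => p1.[x]) 1 (l - 2^-1) x +
  mellin_integrand (fun x => 1 - x ^+ 2) (fun x => (r ^+ 2).[x]) 0 (l - 2^-1) x.
have mD : (R.-ocitv.-measurable).-sigma.-measurable D by exact: measurable_itv.
have i2 := integrable_gmoment 2 p2 l1.
have i1 := integrable_gmoment 1 p1 l1.
have i0 := integrable_gmoment 0 (r ^+ 2) l1.
have i21 := integrableD mD i2 i1.
have ig := integrableD mD i21 i0.
rewrite /gegenbauer_fisher (@integral_closed_open _ g).
- have -> : \int[mu]_(x in D) g x = gmoment 2 l p2 + gmoment 1 l p1 + gmoment 0 l (r ^+ 2).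
    by rewrite RintegralD// RintegralD.
  rewrite -EFinM; congr EFin.
  have E2 : gmoment 2 l p2 = k ^+ 2 / 4 * gmoment 2 l (P ^+ 2) by rewrite gmomentZ.
  have E1 : gmoment 1 l p1 = k * (k1 * h1 - k * S).
    rewrite gmomentZ// (_ : P * r = k1 *: P ^+ 2 + k *: (P * dP)); last first.
      by rewrite /r -!mul_polyC; ring.
    rewrite gmomentD// !gmomentZ//.
    have -> : gmoment 1 l (P * dP) = - S.
      by rewrite gmoment1_gpoly_lt ?size_dgpoly.
    by rewrite mulrN.
  have E0 : gmoment 0 l (r ^+ 2) = k1 ^+ 2 * h + k ^+ 2 * S.
    have -> : r ^+ 2 = k1 ^+ 2 *: P ^+ 2 + (2 * k1 * k) *: (P * dP) + k ^+ 2 *: dP ^+ 2.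
      by rewrite /r -!mul_polyC; ring.
    have z : gmoment 0 l (P * dP) = 0 by rewrite gpoly_orth_lt ?size_dgpoly.
    by rewrite !gmomentD// !gmomentZ// z mulr0 addr0.
  (* In the integral the contributions of [S] cancel. The sum over [k] appears because the second
     derivative of the norm contains [- 2 * S], so the integral exceeds the second logarithmic
     derivative by [2 * S / h]. *)
  have L1 := log_deriv2_of (f := fun y => gnorm y n) (@oA) (fun y y1 => gnorm_gt0 y1 n)
    (fun y y1 => is_derive_gnorm y1 n) (fun y y1 => is_derive_gnorm2 y1 n).
  have L := log_deriv2_unique (@oA) L1 (log_deriv2_gnorm R n) l1.
  rewrite /fisher_closed -L -dgpoly_sqr// E2 E1 E0 -/h -/S -/P -/h1.
  have hn0 : h != 0 by rewrite gt_eqF.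
  rewrite /k1 -/k.
  have -> : 4 * (k ^+ 2 / 4 * gmoment 2 l (P ^+ 2) + k * (- (h1 / (2 * h)) * k * h1 - k * S) +
     ((- (h1 / (2 * h)) * k) ^+ 2 * h + k ^+ 2 * S)) =
     k ^+ 2 * (gmoment 2 l (P ^+ 2) - 2 * (h1 / h) * h1 + (h1 / h) ^+ 2 * h).
    by move: (gmoment _ _ _) => m; field.
  by rewrite kk; move: (gmoment _ _ _) => m; field.
- by apply: eq_integrable ig.
move=> x Dx; rewrite derive1E.
have dsC := is_derive1M (is_derive_sqrt_weight l Dx) (dC x).
rewrite (@derive_val _ _ _ _ _ _ _ dsC).
rewrite (orthonormal_gegenbauerE n l1 (hC l1)) hornerZ -/h -/k -/P.
have w0 : 0 <= gegenbauer_weight l x by exact: powR_ge0.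
have r2E : (r ^+ 2).[x] = (k1 * P.[x] + k * dP.[x]) ^+ 2.
  by rewrite horner_exp hornerD !hornerZ.
have p1E : p1.[x] = k * (P.[x] * (k1 * P.[x] + k * dP.[x])).
  by rewrite /p1 hornerZ hornerM hornerD !hornerZ.
have p2E : p2.[x] = k ^+ 2 / 4 * P.[x] ^+ 2 by rewrite /p2 hornerZ horner_exp.
rewrite /g /mellin_integrand r2E p1E p2E.
have ws : (1 - x ^+ 2) `^ (l - 2^-1) = Num.sqrt (gegenbauer_weight l x) ^+ 2.
  by rewrite sqr_sqrtr.
rewrite ws; move: (Num.sqrt (gegenbauer_weight l x)) (ln _) P.[x] dP.[x] => s L u v.
by field.
Qed.

End FisherIntegral.

(** * Comparison with the stated value, and continuity at 0 *)

Section FisherValue.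
Variable R : realType.

Lemma gegenbauer_fisher_valueE n (l : R) : - 2^-1 < l -> l != 0 ->
  gegenbauer_fisher_value n l = fisher_closed n l.
Proof.
move=> l1 l0.
have n0 : 0 <= n%:R :> R by [].
have nl : n%:R + l != 0.
  case: n n0 => [|n] _; first by rewrite add0r.
  have n1 : 0 <= n%:R :> R by [].
  by rewrite -natr1 gt_eqF//; lra.
have n2l : n%:R + 2 * l != 0.
  case: n n0 {nl} => [|n] _; first by rewrite add0r mulf_neq0.
  have n1 : 0 <= n%:R :> R by [].
  by rewrite -natr1 gt_eqF//; lra.
have t1 : trigamma (n%:R + l) = etrigamma (n%:R + l + 1) + ((n%:R + l) ^+ 2)^-1.
  by rewrite trigammaE//; lra.
have t2 : trigamma (n%:R + 2 * l) = etrigamma (n%:R + 2 * l + 1) + ((n%:R + 2 * l) ^+ 2)^-1.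
  by rewrite trigammaE//; lra.
rewrite /gegenbauer_fisher_value t1 t2 /fisher_closed /gnorm_log2.
case: n n0 nl n2l {t1 t2} => [|n] n0 nl n2l.
  rewrite !big_ord0 /= !add0r in nl n2l *.
  (* At [n = 0] the rational terms are [- 2 / l ^ 2 + 4 / (2 l) ^ 2 + 1 / l ^ 2 = 0]. *)
  by rewrite mulr0; move: (etrigamma _) (etrigamma _) => u v; field; rewrite l0.
have Gn : Gamma (n.+1%:R + 2 * l) = euler_integral (n.+1%:R + 2 * l).
  rewrite /Gamma ifT// -natr1.
  have n1 : 0 <= n%:R :> R by [].
  lra.
have tE (u v a b : R) : a != 0 -> b != 0 -> - (2 * (u + (a ^+ 2)^-1)) + 4 * (v + (b ^+ 2)^-1) +
    1 / a ^+ 2 = 4 * v - 2 * u + (4 / b ^+ 2 - 1 / a ^+ 2).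
  by move=> a0 b0; field; rewrite a0 b0.
rewrite -[n.+1 == 0%N]/false -tE// [RHS]addrC !addrA; congr (_ + _ + _ + _).
rewrite mulr_sumr; apply: eq_bigr => k _; have kn := ltn_ord k.
rewrite /gconnect -signr_odd; case: ifP => o.
  by rewrite expr1 subrr !mul0r !mulr0 mul0r.
(* For [k = 0] this is [Gamma (2 l) l = Gamma (2 l + 1) / 2], valid also for negative [2 l] by
   [Gamma_shift]; here [l != 0] enters. *)
have gk : Gamma (k%:R + 2 * l) * (k%:R + l) = gconst k l.
  rewrite /gconst; case: (k : nat) => [|j] /=.
    rewrite !add0r Gamma_shift ?mulf_neq0//; last lra.
    by field; rewrite l0.
  have j1 : 0 <= j%:R :> R by [].
  rewrite /Gamma ifT 1?mulrC// -natr1; lra.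
rewrite Gn expr0 -[_ * Gamma _ * _]mulrA gk.
have fk : k`!%:R != 0 :> R by rewrite pnatr_eq0 -lt0n fact_gt0.
have nk : n.+1%:R - k%:R != 0 :> R by rewrite subr_eq0 eqr_nat gtn_eqF.
have nk2 : n.+1%:R + k%:R + 2 * l != 0.
  have n1 : 0 <= n%:R :> R by [].
  have k1 : 0 <= k%:R :> R by [].
  by rewrite -natr1 gt_eqF//; lra.
have en : euler_integral (n.+1%:R + 2 * l) != 0.
  have n1 : 0 <= n%:R :> R by [].
  by rewrite gt_eqF// euler_integral_gt0// -natr1; lra.
rewrite [k%:R + n.+1%:R]addrC.
move: (gconst k l) (euler_integral _) (k`!%:R : R) (n.+1)`!%:R en fk => g e f f' e0 f0.
move: nk nk2; move: (n.+1%:R - k%:R) (n.+1%:R + k%:R + 2 * l) (n.+1%:R + l) => s t u s0 t0.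
by field; rewrite e0 f0 s0 t0.
Qed.

Let ex_derive_at (f : R -> R) (x : R) := exists a, is_derive x 1 f a.

Let exD f g x : ex_derive_at f x -> ex_derive_at g x -> ex_derive_at (fun y => f y + g y) x.
Proof. by move=> [a fa] [b gb]; exists (a + b); exact: is_derive1D. Qed.

Let exM f g x : ex_derive_at f x -> ex_derive_at g x -> ex_derive_at (fun y => f y * g y) x.
Proof. by move=> [a fa] [b gb]; eexists; exact: is_derive1M fa gb. Qed.

Let exV f x : f x != 0 -> ex_derive_at f x -> ex_derive_at (fun y => (f y)^-1) x.
Proof. by move=> fx [a fa]; eexists; exact: is_derive1V fx fa. Qed.

Let exC c x : ex_derive_at (fun=> c) x.
Proof. by exists 0; exact: is_derive1_cst. Qed.

Let ex_affine (c b x : R) : ex_derive_at (fun y => b + c * y) x.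
Proof.
exists c; rewrite (_ : (fun y => _) = fun y => c * y + b); first exact: is_derive1_affine.
by apply/funext => y; rewrite addrC.
Qed.

Let ex_compose (f : R -> R) c b : derivable f (b + c * 0) 1 -> ex_derive_at (fun y => f (b + c * y)) 0.
Proof.
have [d dd] := ex_affine c b 0.
move=> /derivableP fa; eexists.
exact: (is_derive1_compose (g := fun y => b + c * y) fa dd).
Qed.

(** Differentiability at 0 is assembled term by term: there the arguments of [etrigamma] and
    [euler_integral] are positive and all denominators are nonzero. *)
Lemma continuous_fisher_closed n : {for (0 : R), continuous (fisher_closed n)}.
Proof.
suff [a da] : ex_derive_at (fisher_closed n) 0 by exact: is_derive1_continuous da.
have n0 : 0 <= n%:R :> R by [].
have dtg (c : R) : ex_derive_at (fun y => etrigamma (n%:R + 1 + c * y)) 0.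
  by apply: ex_compose; apply: derivable_etrigamma; rewrite mulr0 addr0; lra.
have dlog : ex_derive_at (gnorm_log2 n) 0.
  have H := exD (exM (exC 4 0) (dtg 2)) (exM (exC (- 2) 0) (dtg 1)).
  have Hn : ex_derive_at (fun y => if n == 0%N then 0 else
      4 / (n%:R + 2 * y) ^+ 2 - 1 / (n%:R + y) ^+ 2) 0.
    case: n n0 {dtg H} => [|n] _ /=; first exact: exC.
    have n1 : n.+1%:R != 0 :> R by rewrite pnatr_eq0.
    have q2 : (n.+1%:R + 2 * 0) * (n.+1%:R + 2 * 0) != 0 :> R.
      by rewrite mulr0 addr0 mulf_neq0.
    have q1 : (n.+1%:R + 1 * 0) * (n.+1%:R + 1 * 0) != 0 :> R.
      by rewrite mulr0 addr0 mulf_neq0.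
    have a2 := ex_affine 2 n.+1%:R 0; have a1 := ex_affine 1 n.+1%:R 0.
    have := exD (exM (exC 4 0) (exV (f := fun y => (n.+1%:R + 2 * y) * (n.+1%:R + 2 * y)) q2 (exM a2 a2))) (exM (exC (- 1) 0) (exV (f := fun y => (n.+1%:R + 1 * y) * (n.+1%:R + 1 * y)) q1 (exM a1 a1))).
    congr (ex_derive_at _ _); apply/funext => y.
    by rewrite mul1r !expr2 mulN1r div1r.
  have := exD H Hn; congr (ex_derive_at _ _); apply/funext => y.
  have e1 : n%:R + 1 + 2 * y = n%:R + 2 * y + 1 by ring.
  have e2 : n%:R + 1 + 1 * y = n%:R + y + 1 by ring.
  by rewrite e1 e2 mulNr.
have dsum : ex_derive_at (fun l => \sum_(k < n) 8 * gconnect n k l /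
    ((n%:R - k%:R) ^+ 2 * (n%:R + k%:R + 2 * l) ^+ 2)) 0.
  suff H : forall k : 'I_n, ex_derive_at (fun l => 8 * gconnect n k l /
      ((n%:R - k%:R) ^+ 2 * (n%:R + k%:R + 2 * l) ^+ 2)) 0.
    have [d dP] := choice H; exists (\sum_(k < n) d k); exact: (is_derive1_sum dP).
  move=> k; have kn := ltn_ord k.
  have np : 0 < n%:R :> R by rewrite ltr0n (leq_ltn_trans _ kn).
  have k0 : 0 <= k%:R :> R by [].
  have nk : n%:R - k%:R != 0 :> R by rewrite subr_eq0 eqr_nat gtn_eqF.
  have q : (n%:R - k%:R) ^+ 2 * ((n%:R + k%:R + 2 * 0) * (n%:R + k%:R + 2 * 0)) != 0 :> R.
    have q0 : n%:R + k%:R != 0 :> R by rewrite gt_eqF//; lra.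
    by rewrite mulr0 addr0 !mulf_neq0// expf_neq0.
  have dg : ex_derive_at (gconnect n k) 0.
    rewrite /gconnect; case: (odd (n - k)); first exact: exC.
    have deul (c b : R) : 0 < b -> ex_derive_at (fun y => euler_integral (b + c * y)) 0.
      by move=> b0; apply: ex_compose; apply: derivable_euler; rewrite mulr0 addr0.
    have dc : ex_derive_at (gconst k) 0.
      rewrite /gconst; case: (k : nat) => [|j] /=.
        have E := exM (deul 2 1 ltr01) (exC 2^-1 0).
        have e : (fun y : R => euler_integral (2 * y + 1) / 2) =
            (fun y => euler_integral (1 + 2 * y) / 2).
          by apply/funext => y; have -> : 2 * y + 1 = 1 + 2 * y := addrC _ _.
        by rewrite e.
      have jp : 0 < j.+1%:R :> R by rewrite ltr0n.
      have := exM (ex_affine 1 j.+1%:R 0) (deul 2 j.+1%:R jp).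
      by congr (ex_derive_at _ _); apply/funext => y; rewrite mul1r.
    have e0 : euler_integral (n%:R + 2 * 0 : R) != 0.
      by rewrite mulr0 addr0 gt_eqF// euler_integral_gt0.
    have := exM (exM (exM (exM (exM (exC 4 0) (ex_affine 1 n%:R 0)) (exC n`!%:R 0))
      (exC (k`!%:R)^-1 0)) dc) (exV (f := fun y => euler_integral (n%:R + 2 * y)) e0 (deul 2 n%:R np)).
    by congr (ex_derive_at _ _); apply/funext => y; rewrite mul1r.
  have a2 := ex_affine 2 (n%:R + k%:R) 0.
  have := exM (exM (exC 8 0) dg) (exV (f := fun y => (n%:R - k%:R) ^+ 2 * ((n%:R + k%:R + 2 * y) * (n%:R + k%:R + 2 * y)))
    q (exM (exC _ 0) (exM a2 a2))).
  by congr (ex_derive_at _ _); apply/funext => y; rewrite -expr2.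
exact: exD.
Qed.

End FisherValue.

Theorem mainTheorem4 (R : realType) (C : R -> nat -> {poly R})
    (hC : forall l : R, - 2^-1 < l -> orthonormal_gegenbauer l (C l))
    (lam : R) (hlam : - 2^-1 < lam) (n : nat) :
  (lam != 0 ->
     gegenbauer_fisher C n lam = (gegenbauer_fisher_value n lam)%:E) /\
  (lam = 0 ->
     exists2 I : R,
       gegenbauer_fisher C n lam = I%:E
       & gegenbauer_fisher_value n l @[l --> (0 : R)^'] --> I).
Proof.
split=> [l0|->]; first by rewrite gegenbauer_fisherE// gegenbauer_fisher_valueE.
have z1 : - 2^-1 < 0 :> R by lra.
exists (fisher_closed n 0); first exact: gegenbauer_fisherE.
(* The limit runs over the punctured neighbourhood, where [l != 0] and the stated value agrees with
   [fisher_closed]. *)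
have /continuous_withinNx cv := @continuous_fisher_closed R n.
apply: cvg_trans cv; apply: near_eq_cvg; near=> l.
rewrite gegenbauer_fisher_valueE//; last by near: l; exact: nbhs_dnbhs_neq.
near: l; apply: nbhs_dnbhs.
have := open_nbhs_nbhs (conj (@open_gt R (- 2^-1)) z1).
by apply.
Unshelve. all: by end_near. Qed.
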